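(* Let $d\ge 2$ be an integer, let $A,B\in\mathbb{Q}[z]$ with $B\neq 0$, and let $f(z)\in\mathbb{Q}((z^{-1}))$ be a Laurent series satisfying the functional equation $$f(z)=\frac{A(z)}{B(z)}\,f(z^d).$$ Let $b\in\mathbb{Z}$ lie inside the domain of convergence of $f(z)$. Assume that $A(b^{d^m})B(b^{d^m})\neq 0$ for all integers $m\ge 0$ and that $f(b)$ is irrational. Then the irrationality exponent $\mu(f(b))$ is a rational number.
   Context: The irrationality exponent $\mu(\xi)$ of a real number $\xi$ is the supremum of the real numbers $\mu$ such that the inequality $|\xi-p/q|<q^{-\mu}$ has infinitely many rational solutions $p/q$. A Laurent series in $z^{-1}$ converges on a region of the form $|z|>R$; ''inside the domain of convergence'' means $b$ lies in this region. *)

(* Defs.v *)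
From HB Require Import structures.
From mathcomp Require Import all_boot all_order all_algebra.
From mathcomp Require Import all_classical all_reals all_analysis.
From mathcomp Require Import zify.
Set Implicit Arguments.
Unset Strict Implicit.
Unset Printing Implicit Defensive.
Import Order.TTheory GRing.Theory Num.Theory.
Import numFieldNormedType.Exports.
Local Open Scope classical_set_scope.
Local Open Scope ring_scope.

(* An element of Q((z^-1)) is given by its coefficients: [f n] is the
   coefficient of z^n, and it vanishes for all large n. *)
Definition laurent (f : int -> rat) : Prop :=
  exists N : int, forall n : int, N < n -> f n = 0.

Definition laurent_poly (P : {poly rat}) (n : int) : rat :=
  if n is Posz m then P`_m else 0.

(* Cauchy product; for f and g in Q((z^-1)) the sum has finite support. *)
Definition laurent_mul (f g : int -> rat) (n : int) : rat :=
  \sum_(i \in [set: int]) f i * g (n - i).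

(* The expansion of A/B in Q((z^-1)), by long division: the coefficient of z^n
   for n >= 0 is read off the polynomial part of A/B, and the coefficient of
   z^-k is the constant term of the polynomial part of z^k * A/B. *)
Definition laurent_div (A B : {poly rat}) (n : int) : rat :=
  match n with
  | Posz m => (A %/ B)`_m
  | Negz k => ((A * 'X^(k.+1)) %/ B)`_0
  end.

(* f(z^d) *)
Definition laurent_pow (d : nat) (f : int -> rat) (n : int) : rat :=
  if (d%:Z %| n)%Z then f (n %/ d%:Z)%Z else 0.

Section LaurentDivK.

Let divp_shift (A B : {poly rat}) (k j m : nat) : B != 0 ->
  ((A * 'X^(k + j)) %/ B)`_(m + j) = ((A * 'X^k) %/ B)`_m.
Proof.
move=> B0; rewrite {1}exprD mulrA {1}(divp_eq (A * 'X^k) B) mulrDl mulrAC.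
rewrite divpD mulpK// coefD coefMXn ltnNge leq_addl /= addnK.
set r := (A * 'X^k) %% B; suff -> : (r * 'X^j %/ B)`_(m + j) = 0 by rewrite addr0.
apply: nth_default; rewrite size_divp//.
have rB : (size r < size B)%N by rewrite ltn_modp.
have [->|r0] := eqVneq r 0; first by rewrite mul0r size_poly0 sub0n.
rewrite size_mulXn// leq_subLR [leqLHS]addnC addnA leq_add2r.
by rewrite -ltnS (leq_trans rB)// (leq_trans (leqSpred _))// ltnS leq_addr.
Qed.

Let laurent_divE (A B : {poly rat}) (k : nat) (n : int) : B != 0 -> 0 <= n + k%:Z ->
  laurent_div A B n = ((A * 'X^k) %/ B)`_(absz (n + k%:Z)).
Proof.
move=> B0; case: n => [m|m] nk /=.
  by rewrite -[in RHS](add0n k) divp_shift// expr0 mulr1.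
have -> : k = (m.+1 + (k - m.+1))%N by lia.
set j := (k - m.+1)%N.
have -> : absz (Negz m + (m.+1 + j)%N%:Z) = (0 + j)%N by lia.
by rewrite divp_shift.
Qed.

(* [laurent_div A B] is indeed the quotient: B * (A/B) = A in Q((z^-1)). *)
Lemma laurent_divK (A B : {poly rat}) : B != 0 ->
  laurent_mul (laurent_poly B) (laurent_div A B) = laurent_poly A.
Proof.
move=> B0; apply/funext => n; rewrite /laurent_mul.
pose k := (size B + `|n|)%N.
transitivity (\sum_(i < size B) B`_i * laurent_div A B (n - i%:Z)).
  rewrite (@fsbig_ord _ _ _ (size B)
    (fun i => B`_i * laurent_div A B (n - i%:Z))).
  rewrite -(@fsbig_image _ _ _ _ _ `I_(size B) Posz
    (fun i => laurent_poly B i * laurent_div A B (n - i))) /=; last first.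
    by move=> i j _ _ [].
  apply/esym/fsbig_widen => // -[i|i] [_ /=]; last by rewrite mul0r.
  move=> iB; rewrite nth_default ?mul0r// leqNgt; apply/negP => ilt.
  by apply: iB; exists i.
have nk : 0 <= n + k%:Z by rewrite /k; lia.
pose Q := (A * 'X^k) %/ B.
transitivity ((B * Q)`_(absz (n + k%:Z))).
  rewrite coefM; set N := absz (n + k%:Z).
  have sN : (size B <= N.+1)%N by rewrite /N /k; lia.
  rewrite (big_ord_widen _ (fun i => B`_i * laurent_div A B (n - i%:Z)) sN).
  rewrite big_mkcond; apply: eq_bigr => -[i iN] _ /=.
  case: ltnP => iB; last by rewrite nth_default ?mul0r.
  rewrite (@laurent_divE _ _ k)//; last by rewrite /k; lia.
  by congr (_ * _`_ _); rewrite /N; lia.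
have -> : B * Q = A * 'X^k - (A * 'X^k) %% B.
  by apply/eqP; rewrite eq_sym subr_eq [B * Q]mulrC; apply/eqP; exact: divp_eq.
have rB : (size ((A * 'X^k) %% B)%R < size B)%N by rewrite ltn_modp.
rewrite coefB [X in _ - X]nth_default ?subr0; last first.
  by apply: leq_trans (ltnW rB) _; rewrite /k; lia.
rewrite coefMXn; case: n @k nk {Q rB} => [m|m] k nk /=.
  by rewrite ifF; [congr (_`_ _)|]; lia.
by rewrite ifT//; lia.
Qed.

End LaurentDivK.

Section Evaluation.
Variable R : realType.
Implicit Types (f : int -> rat) (x : R).

(* The terms c_(-n) x^(-n) of nonpositive degree. *)
Definition laurent_term f x : R^nat := fun n => ratr (f (- n%:Z)) * x ^- n.

(* The domain of convergence is |z| > [laurent_radius f]. Only the terms of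
   nonpositive degree matter; x = 0 must be excluded since 0^-1 = 0. *)
Definition laurent_radius f : \bar R :=
  ereal_inf [set (`|x|)%:E | x in
    [set x : R | x != 0 /\ cvgn (series (laurent_term f x))]].

Definition laurent_eval f x : R :=
  \sum_(n \in [set: nat]) ratr (f n.+1%:Z) * x ^+ n.+1
  + limn (series (laurent_term f x)).

(* The rational solutions p/q are counted as rational numbers, q being the
   denominator in lowest terms. *)
Definition irrationality_exponent (xi : R) : \bar R :=
  ereal_sup [set mu%:E | mu in
    [set mu : R | infinite_set
      [set r : rat | `|xi - ratr r| < ((denq r)%:~R : R) `^ (- mu)]]].

End Evaluation.

(* Main.v *)
(** Suppose first that |b| >= 2 and put N = d^m.  For every n take a Pade
    approximant p/q of f with deg q <= n and q f - p = O(z^-(n+1)).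
    Substituting z^N and iterating the functional equation gives rational
    numbers r_(n,m) = prod_(j < m) (A/B)(b^(d^j)) * (p/q)(b^N) for which
    both - log |f(b) - r_(n,m)| / N and log den r_(n,m) / N converge as m grows.
    The first limit is a rational multiple of log |b| because p/q approximates
    f(z) to an exact integral order.  So is the second: up to O(d^(m - k)),
    log den r_(n,m) only depends on the reduced denominator of
    prod_(j < k) (A/B)(z^(d^j)) * (p/q)(z^(d^k)) evaluated at b^(d^(m-k)), and
    the degree D_k of this denominator satisfies D_(k+1) = d D_k + g_k with g_k
    eventually periodic; indeed g_k only depends on the truncated orders of that
    rational function at finitely many algebraic numbers, and such an order is
    eventually constant or linear along the orbits of x |-> x^d.
    For n in a window ]M, dM] and all m the r_(n,m) have consecutive heights
    whose ratios of logarithms tend to 1 as M grows, so a rational number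
    approximating f(b) to an order mu > 2 is one of them.  Hence the exponent is
    either 2 or the quotient of the two limits for some n.

    If |b| <= 1, f converges on a region |z| > rho with rho < 1.  For large J the
    coefficients of prod_(j < J) B(z^(d^j)) f(z) = prod_(j < J) A(z^(d^j)) f(z^(d^J))
    have denominators growing more slowly than they decay, so almost all of them
    vanish, and f(b) is rational. *)
Require Import Defs.
From HB Require Import structures.
From mathcomp Require Import all_boot all_order all_algebra all_field.
From mathcomp Require Import all_classical all_reals all_analysis.
From mathcomp Require Import zify ring lra.
Set Implicit Arguments.
Unset Strict Implicit.
Unset Printing Implicit Defensive.
Import Order.TTheory GRing.Theory Num.Theory.
Import numFieldNormedType.Exports.
Local Open Scope classical_set_scope.
Local Open Scope ring_scope.

(** * Rates of growth and rational approximation *)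

Lemma eventually_forall_ltn (P : nat -> nat -> Prop) (K : nat) :
  (forall n, (n < K)%N -> exists M, forall m, (M <= m)%N -> P n m) ->
  exists M, forall n m, (n < K)%N -> (M <= m)%N -> P n m.
Proof.
elim: K => [|K IH] H; first by exists 0%N.
have [n nK|M1 H1] := IH; first by apply: H; rewrite ltnS ltnW.
have [M2 H2] := H K (ltnSn K).
exists (maxn M1 M2) => n m; rewrite ltnS leq_eqVlt => /orP[/eqP->|nK] Mm.
  by apply: H2; apply: leq_trans Mm; rewrite leq_maxr.
by apply: H1 => //; apply: leq_trans Mm; rewrite leq_maxl.
Qed.

Section Rates.
Variable R : realType.
Implicit Types (u : nat -> R) (e : R).

Definition rate (d : nat) u e := forall eps : R, 0 < eps ->
  exists M, forall m, (M <= m)%N -> `|ln (u m) - e * d%:R ^+ m| <= eps * d%:R ^+ m.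

Lemma lt_natr_bound (x : R) : x < (Num.bound `|x|)%:R.
Proof. exact: le_lt_trans (ler_norm x) (archi_boundP (normr_ge0 x)). Qed.

Lemma expdn_unbounded (d : nat) (x : R) : (2 <= d)%N ->
  exists M, forall m, (M <= m)%N -> x <= d%:R ^+ m.
Proof.
move=> hd; exists (Num.bound `|x|) => m Mm.
have h := lt_natr_bound x; apply: (le_trans (ltW h)).
rewrite -natrX ler_nat; apply: (leq_trans Mm).
by apply: ltnW; apply: ltn_expl.
Qed.

Lemma expdn_gt0 (d m : nat) : (2 <= d)%N -> 0 < d%:R ^+ m :> R.
Proof. by move=> hd; rewrite exprn_gt0// ltr0n; lia. Qed.

Lemma ln_denq_ge0 (r : rat) : 0 <= ln ((denq r)%:~R : R).
Proof.
by rewrite ln_ge0// ler1z; have := denq_gt0 r; lia.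
Qed.

Lemma denqR_gt0 (r : rat) : 0 < (denq r)%:~R :> R.
Proof. by rewrite ltr0z denq_gt0. Qed.

Lemma rat_gap (r s : rat) : r != s ->
  1 <= (denq r)%:~R * (denq s)%:~R * `|ratr r - ratr s| :> R.
Proof.
move=> rs.
have dr := denq_neq0 r; have ds := denq_neq0 s.
have drR : (denq r)%:~R != 0 :> R by rewrite intr_eq0.
have dsR : (denq s)%:~R != 0 :> R by rewrite intr_eq0.
have -> : ratr r - ratr s =
  (numq r * denq s - numq s * denq r)%:~R / ((denq r)%:~R * (denq s)%:~R) :> R.
  rewrite /ratr rmorphB !rmorphM/=; field.
  by rewrite drR dsR.
rewrite normrM normfV normrM (gtr0_norm (denqR_gt0 r)) (gtr0_norm (denqR_gt0 s)).
rewrite mulrC divfK ?mulf_neq0// -intr_norm ler1z.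
suff : (numq r * denq s - numq s * denq r) != 0 by lia.
by rewrite subr_eq0; apply: contra rs; rewrite rat_eq.
Qed.

Lemma finite_bounded_denq (xi X : R) :
  finite_set [set r : rat | (denq r)%:~R <= X /\ `|xi - ratr r| <= 1].
Proof.
pose K := Num.bound `|X * (`|xi| + 1)|; pose K' := Num.bound `|X|.
pose s := [seq (i%:Z - K%:Z)%:~R / j%:R : rat | i <- iota 0 (K + K).+1, j <- iota 0 K'.+1].
apply: sub_finite_set (finite_seq s) => r /= [dX hr].
have dpos := denq_gt0 r.
have dK : (`|denq r|%N < K')%N.
  rewrite -(ltr_nat R); apply: le_lt_trans (lt_natr_bound X).
  by rewrite natr_absz intr_norm gtr0_norm ?denqR_gt0.
have nK : (`|numq r|%N < K)%N.
  rewrite -(ltr_nat R); apply: le_lt_trans (lt_natr_bound _).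
  rewrite natr_absz intr_norm.
  have -> : (numq r)%:~R = ratr r * (denq r)%:~R :> R.
    by rewrite /ratr divfK// intr_eq0 denq_neq0.
  rewrite normrM (gtr0_norm (denqR_gt0 r)) mulrC ler_pM ?(ltW (denqR_gt0 r))//.
  have -> : ratr r = xi - (xi - ratr r) by ring.
  by apply: le_trans (ler_normB _ _) _; rewrite lerD2l.
apply/allpairsP; exists (absz (numq r + K%:Z)%R, absz (denq r)); split.
- by rewrite mem_iota /=; move: nK; clear; lia.
- by rewrite mem_iota /=; move: dK; clear; lia.
- have -> : (absz (numq r + K%:Z)%R)%:Z - K%:Z = numq r by lia.
  rewrite -[X in _ / X]/((absz (denq r))%:Z%:~R).
  have -> : (absz (denq r))%:Z = denq r by lia.
  by rewrite divq_num_den.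
Qed.

Lemma ln_rat_gap (r s : rat) : r != s ->
  - (ln ((denq r)%:~R) + ln ((denq s)%:~R)) <= ln (`|ratr r - ratr s| : R).
Proof.
move=> rs; have h := rat_gap rs.
have d0 : 0 < `|ratr r - ratr s| :> R.
  by rewrite normr_gt0 subr_eq0; apply: contra rs => /eqP/fmorph_inj ->.
have := ln_ge0 h; rewrite lnM ?posrE ?mulr_gt0 ?denqR_gt0//.
by rewrite lnM ?posrE ?denqR_gt0//; lra.
Qed.

Lemma lt_powR_denq (xi mu : R) (r : rat) : xi != ratr r ->
  (`|xi - ratr r| < ((denq r)%:~R : R) `^ (- mu)) =
  (ln `|xi - ratr r| < - mu * ln ((denq r)%:~R)).
Proof.
move=> xr; rewrite -ln_powR ltr_ln ?posrE ?powR_gt0 ?denqR_gt0//.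
by rewrite normr_gt0 subr_eq0.
Qed.

Lemma rate_ge0 d u e : (2 <= d)%N -> (forall m, 0 <= ln (u m)) -> rate d u e -> 0 <= e.
Proof.
move=> hd u0 ue; rewrite leNgt; apply/negP => e0.
have [M /(_ M (leqnn _))] := ue (- e / 2) ltac:(lra).
have := u0 M; have := @expdn_gt0 d M hd; rewrite ler_norml => h0 h1 /andP[_ h2].
have : (e / 2) * d%:R ^+ M < 0 by rewrite pmulr_llt0//; lra.
by lra.
Qed.

Lemma ln_addn_le (x y z : R) : 0 < x -> 0 < y -> ln x <= z -> ln y <= z ->
  ln (x + y) <= ln 2 + z.
Proof.
move=> x0 y0 xz yz; rewrite -[z]expRK -lnM ?posrE ?expR_gt0// ?ltr0n//.
rewrite ler_ln ?posrE ?addr_gt0 ?mulr_gt0 ?expR_gt0// mulr2n mulrDl mul1r.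
by apply: lerD; rewrite -[leLHS]lnK ?posrE// ler_expR.
Qed.

Section Approximation.
Variables (d : nat) (hd : (2 <= d)%N) (xi : R) (xi_irr : forall r : rat, xi != ratr r).

Let err0 (r : rat) : 0 < `|xi - ratr r|.
Proof. by rewrite normr_gt0 subr_eq0. Qed.

Lemma rate_denq_gt0 (r : nat -> rat) (e delta : R) :
  rate d (fun m => `|xi - ratr (r m)|) (- e) ->
  rate d (fun m => (denq (r m))%:~R) delta -> delta < e -> 0 < delta.
Proof.
move=> he hdl de.
have dl0 : 0 <= delta by apply: (rate_ge0 hd) hdl => m; exact: ln_denq_ge0.
rewrite lt_neqAle dl0 andbT eq_sym; apply/eqP => dlE; rewrite {}dlE in hdl de dl0.
have d2 : 2 <= d%:R :> R by rewrite ler_nat.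
pose eps := e / (2 * (d%:R + 2)).
have epsE : eps * (2 * (d%:R + 2)) = e by rewrite /eps divfK//; lra.
have eps0 : 0 < eps by rewrite divr_gt0//; lra.
  clearbody eps.
have [M1 H1] := he _ eps0; have [M2 H2] := hdl _ eps0.
have [M3 H3] := expdn_unbounded (2 * ln 2 / e + 1) hd.
pose m := maxn M1 (maxn M2 M3).
have m1 : (M1 <= m)%N by rewrite leq_maxl.
have m2 : (M2 <= m)%N by rewrite /m; lia.
have m3 : (M3 <= m)%N by rewrite /m; lia.
have := H3 m m3; have := H1 m m1; have := H1 m.+1 (leqW m1).
have := H2 m m2; have := H2 m.+1 (leqW m2).
rewrite !ler_norml exprS; have := expdn_gt0 m hd; set D := d%:R ^+ m => D0.
move=> /andP[_ b'] /andP[_ b] /andP[_ a'] /andP[a1 a2] bigD.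
have rr : r m != r m.+1.
  apply/eqP => rr; rewrite -rr in a'.
  have : 0 < (e * (d%:R - 1) - eps * (d%:R + 1)) * D.
    rewrite mulr_gt0// -epsE; nra.
  by lra.
have := ln_rat_gap rr.
have hn : `|ratr (r m) - ratr (r m.+1)| <= `|xi - ratr (r m)| + `|xi - ratr (r m.+1)|.
  have -> : ratr (r m) - ratr (r m.+1) = (xi - ratr (r m.+1)) - (xi - ratr (r m)) by ring.
  by rewrite [leRHS]addrC; exact: ler_normB.
have hp : 0 < `|ratr (r m) - ratr (r m.+1)| :> R.
  by rewrite normr_gt0 subr_eq0; apply: contra rr => /eqP/fmorph_inj ->.
have := hn; rewrite -ler_ln ?posrE ?addr_gt0// => hn'.
have hs : ln (`|xi - ratr (r m)| + `|xi - ratr (r m.+1)|) <= ln 2 + (- (e - eps) * D).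
  apply: ln_addn_le => //; first lra.
  have : 0 <= (e - eps) * (d%:R - 1) * D by rewrite !mulr_ge0 ?ltW// -?epsE; nra.
  by lra.
have : 2 * ln 2 < e * D.
  have : 2 * ln 2 / e < D by lra.
  by rewrite ltr_pdivrMr// [D * e]mulrC.
have : e * D = eps * (2 * (d%:R + 2)) * D by rewrite epsE.
have : 0 <= d%:R * eps * D by rewrite !mulr_ge0//; lra.
by lra.
Qed.

Lemma exists_window (X Y D k : R) (N M : nat) :
  0 < Y -> 0 <= k -> k < N%:R -> (d * N)%:R * Y * d%:R ^+ M < X ->
  exists n m, [/\ (M <= m)%N, (N < n <= d * N)%N,
    X <= (n%:R - k) * Y * d%:R ^+ m & (n%:R - 1 - k) * Y * d%:R ^+ m < X].
Proof.
move=> Y0 k0 kN XM.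
have d2 : 2 <= d%:R :> R by rewrite ler_nat.
have c0 : 0 < ((d * N)%:R - k) * Y.
  rewrite mulr_gt0// subr_gt0 natrM; nra.
have [m0 /(_ m0 (leqnn _)) hm0] := expdn_unbounded (X / (((d * N)%:R - k) * Y)) hd.
have exm : exists m, X <= ((d * N)%:R - k) * Y * d%:R ^+ m.
  by exists m0; rewrite mulrC -ler_pdivrMr.
case: (ex_minnP exm) => m Xm mmin.
have Mm : (M < m)%N.
  rewrite ltnNge; apply/negP => mM.
  have : d%:R ^+ m <= d%:R ^+ M :> R by rewrite ler_weXn2l//; lra.
  have := expdn_gt0 m hd; have := expdn_gt0 M hd => M0 m0' mM'.
  have : ((d * N)%:R - k) * Y * d%:R ^+ m <= (d * N)%:R * Y * d%:R ^+ M.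
    by apply: ler_pM; [exact: ltW|exact: ltW|rewrite ler_pM2r//; lra|].
  lra.
case: m => // m in Xm mmin Mm *.
have {}mmin : ((d * N)%:R - k) * Y * d%:R ^+ m < X.
  by rewrite ltNge; apply/negP => /mmin; rewrite ltnn.
have exn : exists n, X <= (n%:R - k) * Y * d%:R ^+ m.+1 by exists (d * N)%N.
case: (ex_minnP exn) => n Xn nmin.
have D0 := expdn_gt0 m hd; set D' := d%:R ^+ m in D0 mmin *.
exists n, m.+1; split => //; first exact: ltnW.
- rewrite (nmin _ Xm) andbT ltnNge; apply/negP => nN.
  have nN' : n%:R <= N%:R :> R by rewrite ler_nat.
  move: Xn; rewrite exprS -/D' leNgt => /negP; apply.
  apply: le_lt_trans mmin; rewrite natrM.
  have h : (n%:R - k) * d%:R <= d%:R * N%:R - k by nra.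
  by have := ler_wpM2r (ltW (mulr_gt0 Y0 D0)) h; lra.
- rewrite ltNge; apply/negP; case: n => [|n] in Xn nmin *.
    move=> _; move: Xn; rewrite exprS -/D' leNgt => /negP; apply.
    apply: lt_trans mmin.
    rewrite mulr0n sub0r mulNr mulNr.
    have : 0 <= k * Y * (d%:R * D') by rewrite !mulr_ge0//; lra.
    have := mulr_gt0 c0 D0; lra.
  by rewrite -natr1 addrK => /nmin; rewrite ltnn.
Qed.

Lemma finite_approximations (r : nat -> nat -> rat) (L c : R) (e delta : nat -> R)
    (n0 : nat) (mu0 : R) :
  ln 2 <= L -> 0 <= c ->
  (forall n, (n0 <= n)%N -> rate d (fun m => `|xi - ratr (r n m)|) (- e n)) ->
  (forall n, (n0 <= n)%N -> rate d (fun m => (denq (r n m))%:~R) (delta n)) ->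
  (forall n, (n0 <= n)%N -> (n%:R - c) * L <= e n - delta n) ->
  (forall n, (n0 <= n)%N -> delta n <= (n%:R + c) * L) ->
  2 < mu0 ->
  exists2 N, (n0 <= N)%N & forall mu, mu0 <= mu ->
    (forall n, (N < n <= d * N)%N -> e n < mu * delta n) ->
    finite_set [set s : rat | `|xi - ratr s| < ((denq s)%:~R : R) `^ (- mu)].
Proof.
move=> L2 c0 He Hdl Hed Hdc mu2.
have ln2 : 0 < ln 2 :> R by rewrite ln_gt0// ltr1n.
have L0 : 0 < L by lra.
pose k := c + 4.
pose N0 := Num.bound `|(c + 3 + mu0 * (c + 6)) / (mu0 - 2)|.
pose N := (n0 + N0 + Num.bound `|k|)%N.
have kN : k < N%:R.
  by apply: lt_le_trans (lt_natr_bound k) _; rewrite ler_nat /N; lia.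
have NN : (c + 3 + mu0 * (c + 6)) / (mu0 - 2) < N%:R.
  by apply: lt_le_trans (lt_natr_bound _) _; rewrite ler_nat /N -/N0; lia.
have n0N : (n0 <= N)%N by rewrite /N -addnA leq_addr.
clearbody N; clear N0; exists N => //.
move=> mu mumu0 Hmu.
have [M HM] : exists M, forall n m, (n < (d * N).+1)%N -> (M <= m)%N ->
    (N < n)%N -> ln (`|xi - ratr (r n m)|) + (ln (denq (r n m))%:~R + (n%:R - c - 2) * L * d%:R ^+ m) <= 0
  /\ [/\ ln (denq (r n m))%:~R <= (n%:R + c + 1) * L * d%:R ^+ m &
  - mu * ln (denq (r n m))%:~R < ln `|xi - ratr (r n m)|].
  apply: eventually_forall_ltn => n nK.
  have [nN|nN] := leqP n N; first by exists 0%N.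
  have n0n : (n0 <= n)%N by apply: leq_trans n0N (ltnW nN).
  have emu : e n < mu * delta n by apply: Hmu; rewrite nN -ltnS.
  have [M1 H1] := He n n0n _ L0; have [M2 H2] := Hdl n n0n _ L0.
  pose eps := (mu * delta n - e n) / (2 * (mu + 1)).
  have epsE : eps * (2 * (mu + 1)) = mu * delta n - e n by rewrite divfK//; lra.
  have eps0 : 0 < eps by rewrite divr_gt0//; lra.
  clearbody eps.
  have [M3 H3] := He n n0n _ eps0; have [M4 H4] := Hdl n n0n _ eps0.
  exists (M1 + M2 + M3 + M4)%N => m Mm _.
  have [m1 m2 m3 m4] : [/\ M1 <= m, M2 <= m, M3 <= m & M4 <= m]%N by split; clear -Mm; lia.
  move: (H4 m m4) (H3 m m3) (H2 m m2) (H1 m m1) => {H1 H2 H3 H4}.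
  have D0 := expdn_gt0 m hd; set D := d%:R ^+ m in D0 *.
  rewrite !ler_norml => /andP[a1 a2] /andP[b1 b2] /andP[c1 c2] /andP[d1 d2].
  have h1 := ler_wpM2r (ltW D0) (Hdc n n0n).
  have h2 := ler_wpM2r (ltW D0) (Hed n n0n).
  split; first lra.
  split; first lra.
  have : 0 < eps * (mu + 1) * D by rewrite !mulr_gt0//; lra.
  have : 0 <= mu * (ln (denq (r n m))%:~R - (delta n - eps) * D).
    by rewrite mulr_ge0//; lra.
  have : eps * (2 * (mu + 1)) * D = (mu * delta n - e n) * D by rewrite epsE.
  lra.
pose X0 := (d * N)%:R * L * d%:R ^+ M.
apply: sub_finite_set (finite_bounded_denq xi (expR X0)) => s /=.
have dgt0 := denqR_gt0 s; have dln := ln_denq_ge0 s.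
rewrite lt_powR_denq//; set X := ln (denq s)%:~R in dln * => hs; split.
  rewrite -ler_ln ?posrE ?expR_gt0// expRK leNgt; apply/negP => XX0.
  have [|n [m [Mm nN Xle Xlt]]] := @exists_window X L 0 k N M L0 _ kN XX0.
    by rewrite /k; lra.
  have [nN1 nN2] := andP nN.
  have [//|h1 [h2 h3]] := HM n m _ Mm nN1.
  have D0 := expdn_gt0 m hd; set D := d%:R ^+ m in D0 Xle Xlt h1 h2 h3 *.
  have [sE|sE] := eqVneq s (r n m).
    by move: hs h3; rewrite /X sE; lra.
  have := ln_rat_gap sE; rewrite -/X => gap.
  have Nn : N%:R + 1 <= n%:R :> R by rewrite natr1 ler_nat.
  have D1 : 1 <= D by rewrite /D exprn_ege1// ler1n ltnW.
  have L2D : ln 2 <= L * D by rewrite (le_trans L2)// ler_peMr// ltW.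
  have : ln `|ratr s - ratr (r n m)| <= ln (`|xi - ratr s| + `|xi - ratr (r n m)|) :> R.
    have hp : 0 < `|ratr s - ratr (r n m)| :> R.
      by rewrite normr_gt0 subr_eq0; apply: contra sE => /eqP/fmorph_inj ->.
    rewrite ler_ln ?posrE ?addr_gt0//.
    have -> : ratr s - ratr (r n m) = (xi - ratr (r n m)) - (xi - ratr s) by ring.
    by rewrite [leRHS]addrC; exact: ler_normB.
  move=> hsum.
  pose z := - X - (ln (denq (r n m))%:~R).
  have [hz|hz] := lerP (ln `|xi - ratr s|) (z - 2 * ln 2).
    have : ln (`|xi - ratr s| + `|xi - ratr (r n m)|) <= ln 2 + (z - 2 * ln 2) :> R.
      by apply: ln_addn_le => //; rewrite /z; move: Xle; rewrite /k; lra.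
    by rewrite /z in hsum *; lra.
  have hX : mu0 * X < X + (n%:R + c + 3) * L * D.
    have : mu0 * X <= mu * X by rewrite ler_wpM2r.
    by rewrite /z in hz; lra.
  have : (mu0 - 1) * ((n%:R - 1 - k) * L * D) < (mu0 - 1) * X.
    by rewrite ltr_pM2l//; lra.
  have : 0 < ((mu0 - 2) * n%:R - (c + 3 + mu0 * (c + 6)) ) * (L * D).
    have h : (mu0 - 2) * N%:R <= (mu0 - 2) * n%:R by rewrite ler_wpM2l//; lra.
    move: NN; rewrite ltr_pdivrMr; last by rewrite subr_gt0.
    by move=> NN'; rewrite mulr_gt0 ?mulr_gt0// subr_gt0; lra.
  have : 0 <= (mu0 + c + 5) * (L * D) by rewrite !mulr_ge0//; lra.
  by rewrite /k; lra.
have : ln `|xi - ratr s| <= 0.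
  have muX : 0 <= mu * X by rewrite mulr_ge0//; lra.
  lra.
by move=> h; rewrite -ler_ln ?posrE// ln1.
Qed.

End Approximation.
End Rates.

Section Exponent.
Variable R : realType.

Lemma exists_upper_bound_below (S : \bar R) (mu0 : R) (x : nat -> R) (K : nat) :
  (mu0%:E < S)%E -> (forall n, (n < K)%N -> ((x n)%:E < S)%E) ->
  exists mu1, [/\ mu0 <= mu1, (mu1%:E < S)%E & forall n, (n < K)%N -> x n <= mu1].
Proof.
move=> mu0S; elim: K => [|K IH] xS; first by exists mu0.
have [n nK|mu1 [h1 h2 h3]] := IH; first by apply: xS; rewrite ltnS ltnW.
exists (Num.max mu1 (x K)); split.
- by rewrite le_max h1.
- by rewrite EFin_max gt_max h2 xS.
- move=> n; rewrite ltnS leq_eqVlt => /orP[/eqP->|nK].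
    by rewrite le_max lexx orbT.
  by rewrite le_max h3.
Qed.

Variables (d : nat) (hd : (2 <= d)%N) (xi : R) (xi_irr : forall r : rat, xi != ratr r).

Lemma infinite_approximations (r : nat -> rat) (e delta mu : R) :
  rate d (fun m => `|xi - ratr (r m)|) (- e) ->
  rate d (fun m => (denq (r m))%:~R) delta -> 0 < delta -> delta < e -> mu < e / delta ->
  infinite_set [set s : rat | `|xi - ratr s| < ((denq s)%:~R : R) `^ (- mu)].
Proof.
move=> he hdl dl0 de; rewrite ltr_pdivlMr// => mue /finite_seqP[s sE].
have [y hy] : exists y, forall q, q \in s -> y <= ln `|xi - ratr q|.
  elim: s {sE} => [|a s [y hy]]; first by exists 0.
  exists (Num.min y (ln `|xi - ratr a|)) => q; rewrite inE => /orP[/eqP->|qs].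
    by rewrite ge_min lexx orbT.
  by rewrite ge_min hy.
pose mu' := Num.max mu 0.
have mu'0 : 0 <= mu' by rewrite le_max lexx orbT.
have mu'e : mu' * delta < e.
  by rewrite /mu'; case: (lerP mu 0) => _; rewrite ?mul0r; lra.
have mumu' : mu <= mu' by rewrite le_max lexx.
clearbody mu'.
pose eps := (e - mu' * delta) / (2 * (mu' + 1)).
have epsE : eps * (2 * (mu' + 1)) = e - mu' * delta by rewrite divfK//; lra.
have eps0 : 0 < eps by rewrite divr_gt0//; lra.
clearbody eps.
have epse : eps < e.
  have : 0 < eps * (2 * mu' + 1) by rewrite mulr_gt0//; lra.
  have : 0 <= mu' * delta by rewrite mulr_ge0// ltW.
  lra.
have [M1 H1] := he _ eps0; have [M2 H2] := hdl _ eps0.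
have [M3 H3] := @expdn_unbounded R _ ((1 + `|y|) / (e - eps)) hd.
pose m := (M1 + M2 + M3)%N.
have m1 : (M1 <= m)%N by rewrite /m -addnA leq_addr.
have m2 : (M2 <= m)%N by rewrite /m addnAC leq_addl.
have m3 : (M3 <= m)%N by rewrite /m leq_addl.
clearbody m.
move: (H1 m m1) (H2 m m2) (H3 m m3); have := @expdn_gt0 R d m hd.
set D := d%:R ^+ m => D0; clearbody D; rewrite !ler_norml => /andP[a1 a2] /andP[b1 b2].
rewrite ler_pdivrMr; last by rewrite subr_gt0.
move=> bigD.
have dln := @ln_denq_ge0 R (r m).
have : r m \in s.
  suff : [set` s] (r m) by [].
  rewrite -sE /= lt_powR_denq//.
  have : 0 <= (mu' - mu) * ln (denq (r m))%:~R by rewrite mulr_ge0// subr_ge0.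
  have : 0 <= mu' * (delta * D + eps * D - ln (denq (r m))%:~R).
    by rewrite mulr_ge0//; lra.
  have : 0 < eps * (mu' + 1) * D by rewrite !mulr_gt0//; lra.
  have : eps * (2 * (mu' + 1)) * D = (e - mu' * delta) * D by rewrite epsE.
  lra.
move=> /hy; have := ler_norm (- y); rewrite normrN; lra.
Qed.

Lemma rational_exponent (r : nat -> nat -> rat) (L c : R) (e delta : nat -> R)
    (x : nat -> rat) (n0 : nat) :
  ln 2 <= L -> 0 <= c ->
  (forall n, (n0 <= n)%N -> rate d (fun m => `|xi - ratr (r n m)|) (- e n)) ->
  (forall n, (n0 <= n)%N -> rate d (fun m => (denq (r n m))%:~R) (delta n)) ->
  (forall n, (n0 <= n)%N -> (n%:R - c) * L <= e n - delta n) ->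
  (forall n, (n0 <= n)%N -> delta n <= (n%:R + c) * L) ->
  (forall n, (n0 <= n)%N -> e n / delta n = ratr (x n)) ->
  exists q : rat, irrationality_exponent xi = (ratr q : R)%:E.
Proof.
move=> L2 c0 He Hdl Hed Hdc Hx.
have ln2 : 0 < ln 2 :> R by rewrite ln_gt0// ltr1n.
have L0 : 0 < L by lra.
pose n1 := maxn n0 (Num.bound `|c|).
have n01 : (n0 <= n1)%N by rewrite leq_maxl.
have cn1 n : (n1 <= n)%N -> c < n%:R.
  move=> n1n; apply: lt_le_trans (lt_natr_bound c) _; rewrite ler_nat.
  by apply: leq_trans n1n; rewrite leq_maxr.
clearbody n1.
have de n : (n1 <= n)%N -> delta n < e n.
  move=> nn; rewrite -subr_gt0; apply: lt_le_trans (Hed _ (leq_trans n01 nn)).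
  by rewrite mulr_gt0// subr_gt0 cn1.
have dl0 n : (n1 <= n)%N -> 0 < delta n.
  move=> nn; have nn0 := leq_trans n01 nn.
  exact: rate_denq_gt0 (He _ nn0) (Hdl _ nn0) (de _ nn).
have lower n : (n1 <= n)%N -> ((e n / delta n)%:E <= irrationality_exponent xi)%E.
  move=> nn; rewrite leNgt; apply/negP => /[dup] lt.
  case E : (irrationality_exponent xi) lt => [s| |] //.
    rewrite lte_fin => lt _.
    have [mu /andP[h1 h2]] : exists mu, s < mu < e n / delta n.
      by exists ((s + e n / delta n) / 2); rewrite midf_lt ?midf_lt// ?lt_midf.
    have : (mu%:E <= irrationality_exponent xi)%E.
      apply: ereal_sup_ubound; exists mu => //=.
      have nn0 := leq_trans n01 nn.
      exact: infinite_approximations (He _ nn0) (Hdl _ nn0) (dl0 _ nn) (de _ nn) h2.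
    by rewrite E lee_fin leNgt h1.
  move=> _ _.
  have : ((e n / delta n - 1)%:E <= irrationality_exponent xi)%E.
    apply: ereal_sup_ubound; exists (e n / delta n - 1) => //=.
    have nn0 := leq_trans n01 nn.
    apply: infinite_approximations (He _ nn0) (Hdl _ nn0) (dl0 _ nn) (de _ nn) _.
    by lra.
  by rewrite E.
have ge2 : (2%:E <= irrationality_exponent xi)%E.
  rewrite leNgt; apply/negP; have := lower n1 (leqnn _).
  case E : (irrationality_exponent xi) => [s| |] //; rewrite lee_fin lte_fin => _ s2.
  pose n := (n1 + Num.bound `|(c * s + 1) / (2 - s)|)%N.
  have nn : (n1 <= n)%N by rewrite leq_addr.
  have hn : (c * s + 1) / (2 - s) < n%:R.
    by apply: lt_le_trans (lt_natr_bound _) _; rewrite ler_nat leq_addl.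
  have := lower n nn; rewrite E lee_fin ler_pdivrMr ?dl0//.
  move: hn; rewrite ltr_pdivrMr ?subr_gt0// => hn.
  have h1 := Hed n (leq_trans n01 nn); have h2 := Hdc n (leq_trans n01 nn).
  have h3 := dl0 n nn; clearbody n.
  have := mulr_gt0 L0 (_ : 0 < n%:R * (2 - s) - (c * s + 1)); rewrite subr_gt0 => /(_ hn).
  have [s1|s1] := lerP s 1.
    have : 0 <= (1 - s) * delta n by rewrite mulr_ge0//; lra.
    have : 0 < (n%:R - c) * L by rewrite mulr_gt0// subr_gt0 cn1.
    lra.
  have : 0 <= (s - 1) * ((n%:R + c) * L - delta n) by rewrite mulr_ge0//; lra.
  lra.
have [S2|S2] := eqVneq (irrationality_exponent xi) 2%:E.
  by exists 2; rewrite S2 ratr_nat.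
have {ge2 S2} gt2 : (2%:E < irrationality_exponent xi)%E by rewrite lt_neqAle eq_sym S2.
have [mu0 mu02 mu0S] : exists2 mu0, 2 < mu0 & (mu0%:E < irrationality_exponent xi)%E.
  move: gt2; case: (irrationality_exponent xi) => [s| |] //.
    by rewrite lte_fin => s2; exists ((2 + s) / 2); rewrite ?lte_fin; lra.
  by move=> _; exists 3; rewrite ?ltry//; lra.
have [|||||N nN HN] := @finite_approximations R d hd xi xi_irr r L c e delta n1 mu0 L2 c0.
- by move=> n /(leq_trans n01); exact: He.
- by move=> n /(leq_trans n01); exact: Hdl.
- by move=> n /(leq_trans n01); exact: Hed.
- by move=> n /(leq_trans n01); exact: Hdc.
- exact: mu02.
have [[n nn En]|Hn] := pselect (exists2 n, (n1 <= n)%N & irrationality_exponent xi = (e n / delta n)%:E).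
  by exists (x n); rewrite En Hx// (leq_trans n01).
pose y n := if (N < n)%N then e n / delta n else mu0.
have [|mu1 [h1 h2 h3]] := @exists_upper_bound_below (irrationality_exponent xi) mu0 y (d * N).+1 mu0S.
  move=> n _; rewrite /y; case: ifP => // nn.
  have {}nn : (n1 <= n)%N by rewrite (leq_trans nN)// ltnW.
  rewrite lt_neqAle lower// andbT; apply/eqP => En; apply: Hn.
  by exists n.
have [_ [mu hmu <-]] := ereal_sup_gt h2.
rewrite lte_fin => mu1mu; exfalso; apply: hmu; apply: HN; first lra.
move=> n /andP[n2 n3]; have := h3 n; rewrite ltnS n3 /y n2 => /(_ isT) h.
rewrite -ltr_pdivrMr ?(le_lt_trans h)// dl0//.
by rewrite (leq_trans nN)// ltnW.
Qed.

End Exponent.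

(** * Eventually periodic integer sequences *)

Section EventuallyPeriodic.

Definition eventually_periodic (T : Type) (u : nat -> T) :=
  exists P m0, (0 < P)%N /\ forall m, (m0 <= m)%N -> u (m + P)%N = u m.

Lemma eventually_periodicM (T : Type) (u : nat -> T) P m0 k m :
  (forall m, (m0 <= m)%N -> u (m + P)%N = u m) -> (m0 <= m)%N -> u (m + P * k)%N = u m.
Proof.
move=> H; elim: k m => [|k IH] m m0m; first by rewrite muln0 addn0.
by rewrite mulnS addnA IH ?H// (leq_trans m0m)// leq_addr.
Qed.

Lemma eventually_periodic_sum (I : eqType) (s : seq I) (h : I -> nat -> int) :
  (forall i, i \in s -> eventually_periodic (h i)) ->
  eventually_periodic (fun m => \sum_(i <- s) h i m).
Proof.
elim: s => [|a s IH] H.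
  by exists 1%N, 0%N; split => // m _; rewrite !big_nil.
have [|P1 [m1 [P10 H1]]] := H a; first by rewrite inE eqxx.
have [|P2 [m2 [P20 H2]]] := IH; first by move=> i si; apply: H; rewrite inE si orbT.
exists (P1 * P2)%N, (maxn m1 m2); split; first by rewrite muln_gt0 P10.
move=> m; rewrite geq_max => /andP[m1m m2m]; rewrite !big_cons.
rewrite (eventually_periodicM _ H1)//; congr (_ + _).
by rewrite mulnC (eventually_periodicM (u := fun m => \sum_(j <- s) h j m) _ H2).
Qed.

Definition tends_pinfty (u : nat -> int) :=
  forall K : int, exists m0, forall m, (m0 <= m)%N -> K <= u m.

Definition tame (u : nat -> int) :=
  [\/ eventually_periodic u, tends_pinfty u | tends_pinfty (fun m => - u m)].

Lemma tame_comp (u : nat -> int) (phi : int -> int) (K a b : int) :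
  (forall t, K <= t -> phi t = b) -> (forall t, t <= - K -> phi t = a) ->
  tame u -> eventually_periodic (fun m => phi (u m)).
Proof.
move=> Hb Ha [[P [m0 [P0 H]]]|H|H].
- by exists P, m0; split => // m /H ->.
- have [m0 Hm0] := H K; exists 1%N, m0; split => // m mm0.
  by rewrite !Hb// Hm0// (leq_trans mm0)// leq_addr.
- have [m0 Hm0] := H K; exists 1%N, m0; split => // m mm0.
  have Hm1 m' : (m0 <= m')%N -> u m' <= - K by move=> /Hm0; rewrite lerNr.
  by rewrite !Ha// Hm1// (leq_trans mm0)// leq_addr.
Qed.

Lemma drift_pinfty (u : nat -> int) P m0 (c : int) : (0 < P)%N -> 0 < c ->
  (forall m, (m0 <= m)%N -> u (m + P)%N = u m + c) -> tends_pinfty u.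
Proof.
move=> P0 c0 H K.
have iterH k m : (m0 <= m)%N -> u (m + P * k)%N = u m + c * k%:Z.
  move=> mm; elim: k => [|k IH]; first by rewrite muln0 addn0 mulr0 addr0.
  have -> : (m + P * k.+1 = m + P * k + P)%N by rewrite mulnS; lia.
  by rewrite H ?IH; [rewrite -[k.+1]addn1 PoszD; ring | rewrite (leq_trans mm)// leq_addr].
pose W := (\sum_(r < P) `|u (m0 + r)|)%N.
have HW r : (r < P)%N -> (`|u (m0 + r)| <= W)%N.
  by move=> rP; rewrite /W (bigD1 (Ordinal rP))//= leq_addr.
exists (m0 + P * (W + `|K|))%N => m hm.
have m0m : (m0 <= m)%N by apply: leq_trans hm; rewrite leq_addr.
pose k := ((m - m0) %/ P)%N; pose r := ((m - m0) %% P)%N.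
have mE : m = (m0 + r + P * k)%N.
  by rewrite -addnA [(P * k)%N]mulnC [(r + _)%N]addnC -divn_eq subnKC.
have kge : (W + `|K| <= k)%N.
  by rewrite leq_divRL// mulnC; lia.
have hr := HW r (ltn_pmod _ P0).
rewrite mE iterH ?leq_addr//.
have : k%:Z <= c * k%:Z by rewrite ler_peMl//; lia.
move: hr kge; move: (u (m0 + r)%N) => ur; clear; lia.
Qed.

Lemma drift_tame (u : nat -> int) P m0 (c : int) : (0 < P)%N ->
  (forall m, (m0 <= m)%N -> u (m + P)%N = u m + c) -> tame u.
Proof.
move=> P0 H; have [c0|c0|c0] := ltgtP c 0.
- apply: Or33; apply: (@drift_pinfty _ P m0 (- c)) => //; first by rewrite oppr_gt0.
  by move=> m mm; rewrite H// opprD.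
- by apply: Or32; apply: (@drift_pinfty _ P m0 c).
- by apply: Or31; exists P, m0; split => // m /H; rewrite c0 addr0.
Qed.

Lemma affine_tame (u : nat -> int) (d : nat) (c : int) : (0 < d)%N ->
  (forall m, u m.+1 = c + d%:Z * u m) -> tame u.
Proof.
move=> d0 H.
have grow v : (forall m, v m.+2 - v m.+1 = d%:Z * (v m.+1 - v m)) -> 0 < v 1%N - v 0%N ->
    tends_pinfty v.
  move=> Hv v0; have vpos m : 0 < v m.+1 - v m.
    by elim: m => // m IH; rewrite Hv mulr_gt0// ltz_nat.
  have vge m : v 0%N + m%:Z <= v m.
    by elim: m => [|m IH]; [rewrite addr0 | have := vpos m; lia].
  move=> K; exists (`|K| + `|v 0%N|)%N => m hm; have := vge m; lia.
have Hu m : u m.+2 - u m.+1 = d%:Z * (u m.+1 - u m) by rewrite !H; ring.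
have [u0|u0|u0] := ltgtP (u 1%N - u 0%N) 0.
- apply: Or33; apply: grow; last by lia.
  move=> m; transitivity (- (u m.+2 - u m.+1)); first by ring.
  by rewrite Hu; ring.
- by apply: Or32; apply: grow.
- apply: Or31; exists 1%N, 0%N; split => // m _; rewrite addn1.
  apply/eqP; rewrite -subr_eq0; apply/eqP.
  by elim: m => // m IH; rewrite Hu IH mulr0.
Qed.

Lemma periodic_affine_rat (t k : nat -> int) (d : nat) : (2 <= d)%N ->
  (forall m, t m.+1 = d%:Z * t m + k m) -> eventually_periodic k ->
  exists gam : rat, forall (eps : rat) (M : nat), 0 < eps ->
    exists2 m, (M <= m)%N & `|(t m)%:~R / d%:R ^+ m - gam| <= eps.
Proof.
move=> hd Ht [P [m0 [P0 Hk]]].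
pose G m : int := \sum_(i < P) d%:Z ^+ (P - i.+1) * k (m + i)%N.
have tG m : t (m + P)%N = d%:Z ^+ P * t m + G m.
  rewrite /G; elim: (P) => [|Q IH].
    by rewrite big_ord0 addn0 expr0 mul1r addr0.
  rewrite addnS Ht IH big_ord_recr/= subnn expr0 mul1r mulrDr mulrA -exprS addrA.
  congr (_ + _ + _); rewrite mulr_sumr; apply: eq_bigr => i _.
  by rewrite mulrA -exprS -subSn//.
have GP m : (m0 <= m)%N -> G (m + P)%N = G m.
  move=> mm; apply: eq_bigr => i _; rewrite addnAC Hk//.
  by rewrite (leq_trans mm)// leq_addr.
have d1 : 1 < d%:R :> rat by rewrite ltr1n.
have dP : 1 < d%:R ^+ P :> rat by rewrite exprn_egt1// -lt0n.
pose c : rat := (G m0)%:~R / (d%:R ^+ P - 1).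
have cE : c * (d%:R ^+ P - 1) = (G m0)%:~R by rewrite divfK// subr_eq0 gt_eqF.
have tj j : (t (m0 + P * j)%N)%:~R + c = d%:R ^+ (P * j) * ((t m0)%:~R + c).
  elim: j => [|j IH]; first by rewrite muln0 addn0 expr0 mul1r.
  rewrite mulnS [(P + _)%N]addnC addnA tG (eventually_periodicM (u := G) _ GP)//.
  rewrite exprD [d%:R ^+ _ * d%:R ^+ P]mulrC -mulrA -IH.
  by rewrite rmorphD rmorphM rmorphXn/= -cE -pmulrn; ring.
exists (((t m0)%:~R + c) / d%:R ^+ m0) => eps M eps0.
pose j := (M + Num.bound (`|c| / eps))%N.
have jm : (j <= m0 + P * j)%N.
  by rewrite (leq_trans _ (leq_addl _ _))// leq_pmull.
exists (m0 + P * j)%N; first by rewrite (leq_trans _ jm)// leq_addr.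
have := tj j; move/eqP; rewrite eq_sym -subr_eq => /eqP <-.
set D := d%:R ^+ (m0 + P * j).
have DE : D = d%:R ^+ m0 * d%:R ^+ (P * j) by rewrite /D exprD.
have nz i : d%:R ^+ i != 0 :> rat by rewrite expf_neq0// gt_eqF//; apply: lt_trans d1.
have -> : (d%:R ^+ (P * j) * ((t m0)%:~R + c) - c) / D - ((t m0)%:~R + c) / d%:R ^+ m0 = - (c / D).
  rewrite DE; move: (nz m0) (nz (P * j)%N); clear.
  move: (d%:R ^+ m0) (d%:R ^+ (P * j)) ((t m0)%:~R + c) => x y z x0 y0.
  by field; rewrite x0 y0.
have D0 : 0 < D by rewrite exprn_gt0// (lt_trans _ d1).
rewrite normrN normrM normfV (gtr0_norm D0) ler_pdivrMr// mulrC -ler_pdivrMr//.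
apply: le_trans (ltW (archi_boundP _)) _; first by rewrite divr_ge0// ltW.
rewrite /D -natrX ler_nat; apply: leq_trans (ltnW (ltn_expl _ hd)).
by rewrite (leq_trans _ jm)// leq_addl.
Qed.

End EventuallyPeriodic.

(** * Degrees of gcds along the Mahler recursion *)

Section Multiplicity.
Implicit Types (p q : {poly algC}) (x : algC).

Lemma mup_comp_exp (d : nat) x p : (0 < d)%N -> p != 0 ->
  mup x (p \Po 'X^d) = ((if x == 0%R then d else 1) * mup (x ^+ d)%R p)%N.
Proof.
move=> d0 p0; pose c := x ^+ d.
have [k [r + pE]] := multiplicity_XsubC p c.
rewrite p0 /= => rc.
have -> : mup c p = k by rewrite pE mupMr// mup_XsubCX eqxx.
have rx : ~~ root (r \Po 'X^d) x by rewrite /root horner_comp hornerXn.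
rewrite pE comp_polyM rmorphXn/= mupMr// comp_polyB comp_polyX comp_polyC.
have [x0|x0] := eqVneq x 0.
  by rewrite /c x0 expr0n (gtn_eqF d0)/= subr0 -exprM -[X in mup _ (X ^+ _)]subr0 -polyC0 mup_XsubCX eqxx.
have {1}-> : 'X^d - c%:P = ('X - x%:P) * \sum_(i < d) 'X^(d.-1 - i) * x%:P ^+ i.
  by rewrite /c rmorphXn/= subrXX; case: (d) d0 => //= n _; under eq_bigr do rewrite subSS.
rewrite exprMn mupMl ?mup_XsubCX ?eqxx ?mul1n//.
rewrite /root horner_exp expf_eq0 negb_and; apply/orP; right.
rewrite horner_sum; under eq_bigr do rewrite hornerM hornerXn horner_exp hornerC -exprD.
rewrite (eq_bigr (fun=> x ^+ d.-1)); last first.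
  by move=> i _; rewrite subnK// -ltnS prednK.
by rewrite sumr_const card_ord -mulr_natr mulf_neq0 ?expf_neq0// pnatr_eq0 -lt0n.
Qed.

Lemma mup_gcdp x p q : p != 0 -> q != 0 ->
  mup x (gcdp p q) = minn (mup x p) (mup x q).
Proof.
move=> p0 q0; have g0 : gcdp p q != 0 by rewrite gcdp_eq0 (negPf p0).
apply/eqP; rewrite eqn_leq; apply/andP; split.
  rewrite leq_min; apply/andP; split; rewrite mup_geq//.
    by apply: dvdp_trans (dvdp_gcdl p q); rewrite -mup_geq.
  by apply: dvdp_trans (dvdp_gcdr p q); rewrite -mup_geq.
by rewrite mup_geq// dvdp_gcd -!mup_geq// geq_minl geq_minr.
Qed.

Lemma size_mup (s : seq algC) p : p != 0 -> uniq s -> (forall x, root p x -> x \in s) ->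
  (size p).-1 = (\sum_(x <- s) mup x p)%N.
Proof.
move=> p0 us; have [r pE] := closed_field_poly_normal p.
have l0 : lead_coef p != 0 by rewrite lead_coef_eq0.
move=> ps; have rs x : x \in r -> x \in s.
  by move=> xr; apply: ps; rewrite pE rootZ// root_prod_XsubC.
rewrite {1}pE size_scale// size_prod_XsubC /=.
rewrite (eq_bigr (fun x => count_mem x r)); last first.
  by move=> x _; rewrite pE -mul_polyC mupMr ?rootC// mu_prod_XsubC.
elim: r {pE ps} rs => [|a r IH] rs; first by rewrite big1.
rewrite /= IH; last by move=> x xr; apply: rs; rewrite inE xr orbT.
rewrite -(addn1 (bigop _ _ _)) addnC big_split/=; congr (_ + _)%N.
rewrite (bigD1_seq a)//=; last by rewrite rs// inE eqxx.
by rewrite eqxx big1// => x xa; rewrite eq_sym (negPf xa).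
Qed.

End Multiplicity.

Definition gcd_gain (a b : nat) (t : int) : int := Num.min (a%:Z + t) b%:Z - Num.min t 0.

Lemma gcd_gain_ge (a b : nat) (t : int) : a%:Z + b%:Z <= t -> gcd_gain a b t = b%:Z.
Proof. by move=> h; rewrite /gcd_gain !min_r ?subr0//; lia. Qed.

Lemma gcd_gain_le (a b : nat) (t : int) : t <= - (a%:Z + b%:Z) -> gcd_gain a b t = a%:Z.
Proof. by move=> h; rewrite /gcd_gain !min_l ?addrK//; lia. Qed.

Lemma gcd_gainE (a b u v : nat) :
  (minn (a + u) (b + v))%:Z = (minn u v)%:Z + gcd_gain a b (u%:Z - v%:Z).
Proof. rewrite /gcd_gain /Order.min; do 2! case: ifP; lia. Qed.

(** [prod_(j < m) A(z^(d^j)) * p(z^(d^m))] *)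
Fixpoint mahler_poly (K : nzRingType) (d : nat) (A p : {poly K}) (m : nat) : {poly K} :=
  if m is m'.+1 then A * (mahler_poly d A p m' \Po 'X^d) else p.

Lemma size_polyXn_gt1 (K : nzRingType) (d : nat) : (0 < d)%N -> (1 < size ('X^d : {poly K}))%N.
Proof. by rewrite size_polyXn ltnS. Qed.

Section MahlerPoly.
Variables (d : nat) (hd : (2 <= d)%N).

Let d0 : (0 < d)%N. Proof. exact: ltnW. Qed.

Lemma mahler_poly_neq0 (K : idomainType) (A p : {poly K}) m :
  A != 0 -> p != 0 -> mahler_poly d A p m != 0.
Proof.
move=> A0 p0; elim: m => //= m IH.
by rewrite mulf_neq0// comp_poly_eq0// size_polyXn_gt1.
Qed.

Lemma size_mahler_poly (K : idomainType) (A p : {poly K}) m :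
  A != 0 -> p != 0 ->
  (size (mahler_poly d A p m.+1)).-1 = ((size A).-1 + d * (size (mahler_poly d A p m)).-1)%N.
Proof.
move=> A0 p0 /=; have X0 := mahler_poly_neq0 m A0 p0.
have Xd : mahler_poly d A p m \Po 'X^d != 0 by rewrite comp_poly_eq0// size_polyXn_gt1.
have := size_comp_poly (mahler_poly d A p m) 'X^d; rewrite size_polyXn mulnC => <-.
rewrite size_mul//; move: Xd A0; rewrite -!size_poly_gt0.
by case: (size A) => // a; case: (size (_ \Po _)) => // u _ _; rewrite addnS.
Qed.

Lemma mahler_poly_shift (K : comNzRingType) (A p : {poly K}) x m i :
  (mahler_poly d A p (i + m)).[x] =
  (\prod_(j < i) A.[x ^+ (d ^ j)]) * (mahler_poly d A p m).[x ^+ (d ^ i)].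
Proof.
elim: i x => [|i IH] x; first by rewrite big_ord0 mul1r expn0 expr1.
rewrite addSn /= hornerM horner_comp hornerXn IH big_ord_recl expn0 expr1 -mulrA.
congr (_ * (_ * _)); last by rewrite -exprM expnS.
by apply: eq_bigr => j _; rewrite -exprM -expnS.
Qed.

Lemma map_mahler_poly (K L : fieldType) (h : {rmorphism K -> L}) (A p : {poly K}) m :
  map_poly h (mahler_poly d A p m) = mahler_poly d (map_poly h A) (map_poly h p) m.
Proof.
by elim: m => //= m IH; rewrite rmorphM/= map_comp_poly map_polyXn IH.
Qed.

Section Order.
Variables (A B p q : {poly algC}).
Hypotheses (A0 : A != 0) (B0 : B != 0) (p0 : p != 0) (q0 : q != 0).

Definition order_gap m (x : algC) : int :=
  (mup x (mahler_poly d A p m))%:Z - (mup x (mahler_poly d B q m))%:Z.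

Let E x : int := (mup x A)%:Z - (mup x B)%:Z.

Lemma order_gapS m x :
  order_gap m.+1 x = E x + (if x == 0%R then d else 1%N)%:Z * order_gap m (x ^+ d).
Proof.
rewrite /order_gap /E /=.
have X0 := mahler_poly_neq0 m A0 p0; have Y0 := mahler_poly_neq0 m B0 q0.
rewrite !mupM ?comp_poly_eq0 ?size_polyXn_gt1// !mup_comp_exp//.
by rewrite !PoszD !PoszM; ring.
Qed.

Let orbit x i : algC := x ^+ (d ^ i).

Let orbitD x i j : orbit (orbit x i) j = orbit x (i + j).
Proof. by rewrite /orbit -exprM -expnD. Qed.

Lemma order_gap_iter m k x : x != 0 ->
  order_gap (m + k) x = \sum_(i < k) E (orbit x i) + order_gap m (orbit x k).
Proof.
elim: k x => [|k IH] x x0; first by rewrite big_ord0 add0r addn0 /orbit expn0 expr1.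
have orbitS i : orbit (x ^+ d) i = orbit x i.+1 by rewrite /orbit -exprM -expnS.
have orbit0 : orbit x 0 = x by rewrite /orbit expn0 expr1.
rewrite addnS order_gapS (negPf x0) mul1r IH ?expf_neq0// big_ord_recl /= orbit0 orbitS addrA.
by under eq_bigr do rewrite orbitS.
Qed.

Lemma injective_leaves (T : eqType) (y : nat -> T) (s : seq T) : injective y ->
  exists i0, forall i, (i0 <= i)%N -> y i \notin s.
Proof.
move=> yI; elim: s => [|a s [i0 H]]; first by exists 0%N.
have [[j yj]|Hj] := pselect (exists j, y j = a); last first.
  exists i0 => i /H si; rewrite inE (negPf si) orbF.
  by apply/eqP => yi; apply: Hj; exists i.
exists (maxn i0 j.+1) => i; rewrite geq_max => /andP[i0i ji].
rewrite inE negb_or H// andbT; apply/eqP; rewrite -yj => /yI ij.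
by rewrite ij ltnn in ji.
Qed.

Lemma order_gap_tame x : tame (fun m => order_gap m x).
Proof.
have [->|x0] := eqVneq x 0.
  apply: (@affine_tame _ d (E 0)) => // m.
  by rewrite order_gapS eqxx expr0n (gtn_eqF d0).
have x0' i : orbit x i != 0 by rewrite expf_neq0.
have [yI|] := pselect (injective (orbit x)).
  pose roots (r : {poly algC}) := sval (closed_field_poly_normal r).
  have rootsP r z : r != 0 -> z \notin roots r -> mup z r = 0%N.
    move=> r0; rewrite /roots; case: closed_field_poly_normal => s /= rE zs.
    by apply: mupNroot; rewrite rE rootZ ?lead_coef_eq0// root_prod_XsubC.
  have [i0 Hi] := injective_leaves (roots A ++ roots B ++ roots p ++ roots q) yI.
  have Hi' i : (i0 <= i)%N -> [/\ mup (orbit x i) A = 0, mup (orbit x i) B = 0,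
      mup (orbit x i) p = 0 & mup (orbit x i) q = 0]%N.
    move=> /Hi; rewrite !mem_cat !negb_or => /and4P[hA hB hp hq].
    by split; apply: rootsP.
  apply: (@drift_tame _ 1 i0 0) => // m mm; rewrite addr0.
  suff c m' : (i0 <= m')%N -> order_gap m' x = \sum_(i < i0) E (orbit x i).
    by rewrite !c// (leq_trans mm)// leq_addr.
  move=> mm'; rewrite -{1}(subnK mm') order_gap_iter//.
  suff -> : order_gap (m' - i0) (orbit x i0) = 0 by rewrite addr0.
  rewrite -[(m' - i0)%N]add0n order_gap_iter// big1 => [|i _]; last first.
    rewrite orbitD /E; have [|-> -> _ _] := Hi' (i0 + i)%N; first exact: leq_addr.
    by rewrite subrr.
  rewrite orbitD /order_gap /=; have [|_ _ -> ->] := Hi' (i0 + (m' - i0))%N; first exact: leq_addr.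
  by rewrite subrr.
move=> /existsNP[i /existsNP[j /not_implyP[yij /eqP ij]]].
wlog lij : i j yij ij / (i < j)%N.
  move=> W; have [ltij|ltji|eij] := ltngtP i j; first exact: W ltij.
    by apply: W ltji; rewrite // eq_sym.
  by rewrite eij eqxx in ij.
pose P := (j - i)%N.
pose C := \sum_(l < P) E (orbit (orbit x i) l).
apply: (@drift_tame _ P i C); first by rewrite subn_gt0.
move=> m im; rewrite -(subnK im) -addnA [(i + P)%N]addnC addnA order_gap_iter//.
rewrite [in RHS]order_gap_iter// [order_gap (_ + P) _]order_gap_iter//.
by rewrite orbitD subnKC 1?ltnW// -yij /C; ring.
Qed.

Let G m := gcdp (mahler_poly d A p m) (mahler_poly d B q m).

Lemma size_gcd_mahler_poly : exists2 h : nat -> int, eventually_periodic h &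
  forall m, ((size (G m.+1)).-1)%:Z = d%:Z * ((size (G m)).-1)%:Z + h m.
Proof.
pose roots (r : {poly algC}) := sval (closed_field_poly_normal r).
have rootsP r z : r != 0 -> root r z = (z \in roots r).
  move=> r0; rewrite /roots; case: closed_field_poly_normal => s /= rE.
  by rewrite rE rootZ ?lead_coef_eq0// root_prod_XsubC.
pose S := undup (roots A ++ roots B).
pose phi x (t : int) : int := gcd_gain (mup x A) (mup x B) t.
pose rho m x : int := (if x == 0%R then d else 1%N)%:Z * order_gap m (x ^+ d).
exists (fun m => \sum_(x <- S) phi x (rho m x)).
  apply: eventually_periodic_sum => x _.
  have tx : tame (fun m => (if x == 0%R then d else 1%N)%:Z * order_gap m (x ^+ d)).
    case: ifP => _; last by under eq_fun do rewrite mul1r; exact: order_gap_tame.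
    have [[P [m0 [P0 H]]]|H|H] := order_gap_tame (x ^+ d).
    - by apply: Or31; exists P, m0; split => // m mm; rewrite H.
    - apply: Or32 => K; have [m0 Hm] := H `|K|; exists m0 => m /Hm; nia.
    - apply: Or33 => K; have [m0 Hm] := H `|K|; exists m0 => m /Hm; nia.
  apply: (@tame_comp _ (phi x) ((mup x A)%:Z + (mup x B)%:Z) (mup x A)%:Z (mup x B)%:Z) => // t ht.
  - exact: gcd_gain_ge.
  - exact: gcd_gain_le.
move=> m.
have X0 := mahler_poly_neq0 m A0 p0; have Y0 := mahler_poly_neq0 m B0 q0.
have X1 := mahler_poly_neq0 m.+1 A0 p0; have Y1 := mahler_poly_neq0 m.+1 B0 q0.
set X := mahler_poly d A p m in X0; set Y := mahler_poly d B q m in Y0.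
have sz1 := size_polyXn_gt1 algC d0.
have Xd : X \Po 'X^d != 0 by rewrite comp_poly_eq0.
have Yd : Y \Po 'X^d != 0 by rewrite comp_poly_eq0.
pose T := undup (roots (X \Po 'X^d) ++ S).
have uT : uniq T by rewrite undup_uniq.
have g0 : G m != 0 by rewrite gcdp_eq0 (negPf X0).
have gd0 : G m \Po 'X^d != 0 by rewrite comp_poly_eq0.
have g1 : G m.+1 != 0 by rewrite gcdp_eq0 (negPf X1).
have -> : (d%:Z * ((size (G m)).-1)%:Z = ((size (G m \Po 'X^d)).-1)%:Z).
  by rewrite size_comp_poly size_polyXn mulnC PoszM.
rewrite (size_mup (s := T) gd0)//; last first.
  move=> x; rewrite /root horner_comp => gx.
  rewrite mem_undup mem_cat -rootsP// /root horner_comp.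
  by have /dvdpP[c ->] := dvdp_gcdl X Y; rewrite hornerM (eqP gx) mulr0 eqxx.
rewrite (size_mup (s := T) g1)//; last first.
  move=> x; rewrite root_gcd => /andP[/= + _].
  by rewrite rootM !mem_undup !mem_cat mem_undup mem_cat !rootsP// => /orP[]->; rewrite ?orbT.
rewrite ![(\sum_(_ <- T) _)%N%:Z](big_morph Posz PoszD erefl).
have -> : \sum_(x <- S) phi x (rho m x) = \sum_(x <- T) phi x (rho m x).
  rewrite [RHS](bigID (mem S))/= [X in _ = _ + X]big1_seq ?addr0; last first.
    move=> x /andP[xS _]; rewrite mem_undup mem_cat -!rootsP// negb_or in xS.
    have /andP[/mupNroot a /mupNroot b] := xS.
    by rewrite /phi a b /gcd_gain add0r subrr.
  rewrite -[RHS]big_filter; apply: perm_big; apply: uniq_perm.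
  - by rewrite undup_uniq.
  - by rewrite filter_uniq.
  - by move=> x; rewrite mem_filter [x \in T]mem_undup mem_cat; case: (x \in S); rewrite ?orbT.
rewrite -big_split/=; apply: eq_bigr => x _.
rewrite mup_gcdp// mup_comp_exp// mup_gcdp//= !mupM// !mup_comp_exp//.
rewrite /phi /rho /order_gap -/X -/Y gcd_gainE -minnMr mulrBr.
by congr (_ + gcd_gain _ _ _).
Qed.

End Order.

Lemma reduced_degree_rat (A B p q : {poly rat}) :
  A != 0 -> B != 0 -> p != 0 -> q != 0 ->
  exists gam : rat, forall (eps : rat) (M : nat), 0 < eps -> exists2 m, (M <= m)%N &
    `|((size (mahler_poly d B q m %/ gcdp (mahler_poly d A p m) (mahler_poly d B q m))).-1)%:R
      / d%:R ^+ m - gam| <= eps.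
Proof.
move=> A0 B0 p0 q0.
pose h : {rmorphism rat -> algC} := ratr.
have map0 r : r != 0 -> map_poly h r != 0 by rewrite map_poly_eq0.
have [k kper kE] := size_gcd_mahler_poly (map0 _ A0) (map0 _ B0) (map0 _ p0) (map0 _ q0).
pose X m := mahler_poly d A p m; pose Y m := mahler_poly d B q m.
pose t m : int := ((size (Y m %/ gcdp (X m) (Y m))).-1)%:Z.
have tE m : t m = ((size (Y m)).-1)%:Z - ((size (gcdp (X m) (Y m))).-1)%:Z.
  have Y0 : Y m != 0 by exact: mahler_poly_neq0.
  have g0 : gcdp (X m) (Y m) != 0 by rewrite gcdp_eq0 negb_and Y0 orbT.
  rewrite /t size_divp//; have := dvdp_leq Y0 (dvdp_gcdr (X m) (Y m)).
  by move: g0; rewrite -size_poly_gt0; move: (size (gcdp _ _)) (size (Y m)) => u v; lia.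
apply: (@periodic_affine_rat t (fun m => ((size B).-1)%:Z - k m) d hd).
  move=> m; rewrite !tE; have := kE m.
  rewrite -!map_mahler_poly -!gcdp_map !size_map_poly -/(X _) -/(X _) -/(Y _) -/(Y _) => ->.
  by rewrite size_mahler_poly// PoszD PoszM; ring.
have [P [m0 [P0 H]]] := kper; exists P, m0; split => // m /H ->.
by [].
Qed.

End MahlerPoly.

(** * Heights of values of rational functions *)

Lemma denq_frac_le (u v : int) : v != 0 -> denq (u%:~R / v%:~R) <= `|v|.
Proof.
move=> v0; set r := _ / _ : rat.
have h : numq r * v = u * denq r.
  apply: (@intr_inj rat); rewrite !rmorphM/= numqE /r mulrAC divfK//.
  by rewrite intr_eq0.
have : (denq r %| numq r * v)%Z by rewrite h dvdz_mull.
rewrite Gauss_dvdzr; last by rewrite coprimezE coprime_sym coprime_num_den.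
rewrite dvdzE => /dvdn_leq; rewrite absz_gt0 => /(_ v0).
by have := denq_gt0 r; lia.
Qed.

Section Heights.
Variable R : realType.
Implicit Types (r s t : rat) (P Q : {poly rat}).

Definition lden r : R := ln ((denq r)%:~R).

Lemma lden_frac_le (u v : int) : v != 0 -> lden (u%:~R / v%:~R) <= ln (`|v|%:~R : R).
Proof.
move=> v0; rewrite /lden ler_ln ?posrE ?denqR_gt0//; last by rewrite ltr0z normr_gt0.
by rewrite ler_int denq_frac_le.
Qed.

Lemma lden_mul s t : lden (s * t) <= lden s + lden t.
Proof.
have -> : s * t = (numq s * numq t)%:~R / (denq s * denq t)%:~R.
  rewrite -{1}[s]divq_num_den -{1}[t]divq_num_den !rmorphM/=; field.
  by rewrite !intr_eq0 !denq_neq0.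
apply: le_trans (lden_frac_le _ _) _; first by rewrite mulf_neq0 ?denq_neq0.
by rewrite normrM !gtr0_norm ?denq_gt0// rmorphM/= lnM ?posrE ?denqR_gt0.
Qed.

Lemma lden_mulN s t : s != 0 -> lden t <= lden (s * t) + lden s^-1.
Proof.
by move=> s0; have := lden_mul s^-1 (s * t); rewrite mulKf// addrC.
Qed.

Lemma lden_prod_mul (i : nat) (s : nat -> rat) t (c : nat -> R) :
  (forall j, s j != 0) -> (forall j, lden (s j) <= c j) -> (forall j, lden (s j)^-1 <= c j) ->
  `|lden ((\prod_(j < i) s j) * t) - lden t| <= \sum_(j < i) c j.
Proof.
move=> s0 h1 h2; elim: i t => [|i IH] t; first by rewrite !big_ord0 mul1r subrr normr0.
rewrite !big_ord_recr/= -mulrA; have := IH (s i * t).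
have := lden_mul (s i) t; have := lden_mulN t (s0 i); have := h1 i; have := h2 i.
rewrite !ler_norml => ? ? ? ? /andP[? ?]; apply/andP; split; lra.
Qed.

Lemma ln_close (u v : R) : v != 0 -> `|u - v| <= `|v| / 2 ->
  u != 0 /\ `|ln `|u| - ln `|v| | <= ln 2.
Proof.
move=> v0 uv; have v0' : 0 < `|v| by rewrite normr_gt0.
have h1 : `|v| / 2 <= `|u|.
  have := ler_normB u (u - v); rewrite opprB addrC subrK; lra.
have h2 : `|u| <= `|v| * 2.
  have := ler_normD v (u - v); rewrite addrC subrK; lra.
have u0 : 0 < `|u| by lra.
split; first by rewrite -normr_gt0.
have l1 : ln `|v| - ln 2 <= ln `|u|.
  by rewrite -ln_div ?posrE// ler_ln ?posrE// divr_gt0.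
have l2 : ln `|u| <= ln `|v| + ln 2.
  by rewrite -lnM ?posrE// ler_ln ?posrE// mulr_gt0.
by rewrite ler_norml; apply/andP; split; lra.
Qed.

Lemma poly_growth P : P != 0 -> exists (C : R) (X0 : R), forall x : int,
  X0 <= `|x%:~R| -> P.[x%:~R] != 0 /\
  `|ln `|ratr P.[x%:~R] : R| - ((size P).-1)%:R * ln `|x%:~R| | <= C.
Proof.
move=> P0; pose n := (size P).-1; pose c : R := ratr (lead_coef P).
have c0 : 0 < `|c| by rewrite normr_gt0 fmorph_eq0 lead_coef_eq0.
pose S : R := \sum_(i < n) `|ratr P`_i|.
have S0 : 0 <= S by apply: sumr_ge0.
exists (ln 2 + `|ln `|c| |), (1 + 2 * S / `|c|) => x xX.
have x1 : 1 <= `|x%:~R : R|.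
  by apply: le_trans xX; rewrite lerDl divr_ge0// mulr_ge0.
have x0 : 0 < `|x%:~R : R| by lra.
pose v : R := c * x%:~R ^+ n.
have v0 : v != 0 by rewrite mulf_neq0 ?expf_neq0// -normr_gt0.
have [|] := @ln_close (ratr P.[x%:~R]) v v0.
  have -> : ratr P.[x%:~R] - v = \sum_(i < n) ratr P`_i * x%:~R ^+ i.
    rewrite horner_coef rmorph_sum/= -/n /v /c lead_coefE -/n.
    have -> : size P = n.+1 by rewrite /n prednK// lt0n size_poly_eq0.
    rewrite big_ord_recr/= rmorphM/= rmorphXn/= ratr_int addrK.
    by apply: eq_bigr => i _; rewrite rmorphM/= rmorphXn/= ratr_int.
  apply: le_trans (ler_norm_sum _ _ _) _.
  have [n0|n0] := posnP n.
    rewrite n0 big_ord0; rewrite divr_ge0//.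
  have : \sum_(i < n) `|ratr P`_i * x%:~R ^+ i| <= S * `|x%:~R| ^+ n.-1.
    rewrite /S mulr_suml; apply: ler_sum => i _.
    rewrite normrM normrX ler_wpM2l// ler_weXn2l//.
    by rewrite -ltnS prednK.
  move=> /le_trans; apply.
  rewrite /v normrM normrX -{2}(prednK n0) exprS.
  have y0 : 0 < `|x%:~R : R| ^+ n.-1 by rewrite exprn_gt0.
  have : S * 2 <= `|c| * `|x%:~R|.
    have : 2 * S / `|c| <= `|x%:~R| by lra.
    by rewrite ler_pdivrMr// mulrC [leRHS]mulrC.
  rewrite -(ler_pM2r y0); lra.
rewrite fmorph_eq0 => Px0 h; split => //.
have lnv : ln `|v| = ln `|c| + n%:R * ln `|x%:~R|.
  by rewrite /v normrM normrX lnM ?posrE ?exprn_gt0// lnXn// mulr_natl.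
have := ler_norm (ln `|c|); have := ler_norm (- ln `|c|); rewrite normrN.
by move: h; rewrite lnv !ler_norml -/n => /andP[? ?] ? ?; apply/andP; split; lra.
Qed.

Lemma poly_int_clear P : exists2 N : int, N != 0 &
  forall x : int, exists z : int, P.[x%:~R] = z%:~R / N%:~R.
Proof.
have [q [a a0 ->]] := rat_poly_scale P; exists a => // x; exists q.[x].
by rewrite hornerZ horner_map/= mulrC.
Qed.

Lemma lden_poly_le P : exists C : R, forall x : int, P.[x%:~R] != 0 ->
  lden (P.[x%:~R])^-1 <= ln `|ratr P.[x%:~R]| + C.
Proof.
have [N N0 H] := poly_int_clear P; exists (ln (`|N|%:~R)) => x; have [z ->] := H x => z0.
have N0' : 0 < `|N%:~R : R| by rewrite normr_gt0 intr_eq0.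
have zn : z != 0 by apply: contra z0 => /eqP->; rewrite mul0r.
rewrite invfM invrK mulrC; apply: le_trans (lden_frac_le _ zn) _.
have z0' : 0 < `|z%:~R : R| by rewrite normr_gt0 intr_eq0.
by rewrite fmorph_div/= !ratr_int normrM normfV ln_div ?posrE// !intr_norm subrK.
Qed.

Lemma lden_quot_le P Q : Q != 0 -> exists C : R, forall x : int, Q.[x%:~R] != 0 ->
  lden (P.[x%:~R] / Q.[x%:~R]) <= ln `|ratr Q.[x%:~R]| + C.
Proof.
move=> Q0; have [N N0 H] := poly_int_clear P; have [C HC] := lden_poly_le Q.
exists (C + ln (`|N|%:~R)) => x Qx; have [z ->] := H x.
apply: le_trans (lden_mul _ _) _; rewrite addrC addrA; apply: lerD; first exact: HC.
exact: lden_frac_le.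
Qed.

Lemma lden_coprime P Q : coprimep P Q -> Q != 0 -> exists C X0 : R, forall x : int,
  X0 <= `|x%:~R| ->
  `|lden (P.[x%:~R] / Q.[x%:~R]) - ((size Q).-1)%:R * ln `|x%:~R| | <= C.
Proof.
move=> /Bezout_eq1_coprimepP[[U V] /= UV] Q0.
have [C1 [X0 HQ]] := poly_growth Q0.
have [C2 HC2] := lden_quot_le P Q0.
have [N1 N10 HU] := poly_int_clear U; have [N2 N20 HV] := poly_int_clear V.
pose C3 : R := ln (`|N1 * N2|%:~R).
exists (C1 + `|C2| + `|C3|), X0 => x xX; have [Qx0 hQ] := HQ x xX.
have h2 := HC2 x Qx0; set r := _ / _ in h2 *.
have h3 : ln `|ratr Q.[x%:~R]| <= lden r + C3.
  have [u Ux] := HU x; have [v Vx] := HV x.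
  have := congr1 (fun p => p.[x%:~R]) UV; rewrite hornerD !hornerM hornerC Ux Vx => UVx.
  pose z : int := u * N2 * numq r + v * N1 * denq r.
  have n1 : N1%:~R != 0 :> rat by rewrite intr_eq0.
  have n2 : N2%:~R != 0 :> rat by rewrite intr_eq0.
  have zE : z%:~R * Q.[x%:~R] = (N1 * N2 * denq r)%:~R.
    have PE : P.[x%:~R] = r * Q.[x%:~R] by rewrite /r divfK.
    rewrite PE in UVx.
    transitivity ((N1 * N2 * denq r)%:~R *
      (u%:~R / N1%:~R * (r * Q.[x%:~R]) + v%:~R / N2%:~R * Q.[x%:~R])); last first.
      by rewrite UVx mulr1.
    by rewrite /z rmorphD !rmorphM/= numqE; field; rewrite n1 n2.
  have z0 : z != 0.
    apply/eqP => z0; move/eqP: zE; rewrite z0 mul0r eq_sym intr_eq0.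
    by rewrite !mulf_eq0 (negPf N10) (negPf N20) (negPf (denq_neq0 r)).
  have : `|ratr Q.[x%:~R] : R| <= `|(N1 * N2 * denq r)%:~R|.
    have <- : ratr (z%:~R * Q.[x%:~R]) = (N1 * N2 * denq r)%:~R :> R.
      by rewrite zE ratr_int.
    rewrite rmorphM/= ratr_int [leRHS]normrM ler_peMl// -intr_norm ler1z.
    by move: z0; clear; lia.
  have Q0' : 0 < `|ratr Q.[x%:~R] : R| by rewrite normr_gt0 fmorph_eq0.
  have NE : `|(N1 * N2 * denq r)%:~R : R| = `|N1 * N2|%:~R * (denq r)%:~R.
    by rewrite [in LHS]rmorphM/= [LHS]normrM (gtr0_norm (denqR_gt0 _ _)) -intr_norm.
  have N0 : 0 < (`|N1 * N2|%:~R : R) by rewrite ltr0z normr_gt0 mulf_neq0.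
  have DR : 0 < ((denq r)%:~R : R) := denqR_gt0 R r.
  rewrite NE => h; have : ln `|ratr Q.[x%:~R]| <= ln (`|N1 * N2|%:~R * (denq r)%:~R : R).
    by rewrite ler_ln ?posrE// mulr_gt0.
  by rewrite lnM ?posrE// addrC.
have := ler_norm C2; have := ler_norm C3.
have := ler_norm (- C2); have := ler_norm (- C3); rewrite !normrN.
by move: hQ; rewrite !ler_norml => /andP[? ?] ? ? ? ?; apply/andP; split; lra.
Qed.

End Heights.

(** * Growth along the orbit b ^+ (d ^ m) *)

Section OrbitRates.
Variables (R : realType) (d : nat) (hd : (2 <= d)%N) (b : int) (hb : (2 <= `|b|)%N).

Let d0 : (0 < d)%N. Proof. exact: ltnW. Qed.
Let x j : int := b ^+ (d ^ j).
Let L : R := ln `|b%:~R|.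

Let b2 : 2 <= `|b%:~R : R|. Proof. by rewrite -intr_norm (ler_int _ 2) /=; lia. Qed.

Lemma ln_orbit_base_ge : ln 2 <= L.
Proof. by rewrite /L ler_ln ?posrE//; apply: lt_le_trans b2. Qed.

Let L0 : 0 < L.
Proof. by apply: lt_le_trans ln_orbit_base_ge; rewrite ln_gt0// ltr1n. Qed.

Lemma ln_orbit j : ln `|(x j)%:~R : R| = L * d%:R ^+ j.
Proof.
rewrite /x rmorphXn/= normrX lnXn; last by apply: lt_le_trans b2.
by rewrite -natrX mulr_natr.
Qed.

Lemma orbit_unbounded (X : R) : exists M, forall j, (M <= j)%N -> X <= `|(x j)%:~R|.
Proof.
have [M H] := @expdn_unbounded R d X hd; exists M => j /H h.
have x0 : 0 < `|(x j)%:~R : R|.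
  rewrite normr_gt0 intr_eq0 expf_neq0//; by move: hb; clear; lia.
apply: (le_trans h); rewrite /x rmorphXn/= normrX -natrX.
apply: (@le_trans _ _ ((2 ^ (d ^ j))%:R)); first by rewrite ler_nat ltnW// ltn_expl.
by rewrite natrX lerXn2r// nnegrE// (le_trans _ b2).
Qed.

Lemma bounded_of_eventually (u : nat -> R) (C : R) (M : nat) :
  (forall j, (M <= j)%N -> u j <= C) -> exists2 C', 0 <= C' & forall j, u j <= C'.
Proof.
move=> H; exists (`|C| + \sum_(j < M) `|u j|); first by rewrite addr_ge0// sumr_ge0.
move=> j; have [Mj|jM] := leqP M j.
  apply: (le_trans (H j Mj)); apply: (le_trans (ler_norm _)).
  by rewrite lerDl sumr_ge0.
rewrite (bigD1 (Ordinal jM))//= addrCA; apply: (le_trans (ler_norm _)).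
by rewrite lerDl addr_ge0// sumr_ge0.
Qed.

Lemma orbit_growth_eventually (P : {poly rat}) : P != 0 ->
  exists (C : R) M, forall j, (M <= j)%N -> P.[(x j)%:~R] != 0 /\
  `|ln `|ratr P.[(x j)%:~R] : R| - ((size P).-1)%:R * (L * d%:R ^+ j)| <= C.
Proof.
move=> /(@poly_growth R)[C [X0 H]]; have [M HM] := orbit_unbounded X0.
by exists C, M => j /HM /H; rewrite ln_orbit.
Qed.

Lemma orbit_growth (P : {poly rat}) : (forall j, P.[(x j)%:~R] != 0) ->
  exists2 C : R, 0 <= C & forall j,
  `|ln `|ratr P.[(x j)%:~R] : R| - ((size P).-1)%:R * (L * d%:R ^+ j)| <= C.
Proof.
move=> Px; have P0 : P != 0 by apply: contraNneq (Px 0%N) => ->; rewrite horner0.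
have [C [M H]] := orbit_growth_eventually P0.
by apply: (@bounded_of_eventually _ C M) => j /H[].
Qed.

Variables (A B : {poly rat}).
Hypotheses (hA : forall j, A.[(x j)%:~R] != 0) (hB : forall j, B.[(x j)%:~R] != 0).

Let A0 : A != 0. Proof. by apply: contraNneq (hA 0%N) => ->; rewrite horner0. Qed.
Let B0 : B != 0. Proof. by apply: contraNneq (hB 0%N) => ->; rewrite horner0. Qed.

Let s j : rat := A.[(x j)%:~R] / B.[(x j)%:~R].

Let s0 j : s j != 0. Proof. by rewrite mulf_neq0// invr_eq0. Qed.

Lemma expr_ge1 j : 1 <= d%:R ^+ j :> R.
Proof. by rewrite exprn_ege1// ler1n. Qed.

Lemma lden_orbit_quot (P Q : {poly rat}) : (forall j, Q.[(x j)%:~R] != 0) ->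
  exists2 C : R, 0 <= C & forall j, lden R (P.[(x j)%:~R] / Q.[(x j)%:~R]) <= C * d%:R ^+ j.
Proof.
move=> Qx; have Q0 : Q != 0 by apply: contraNneq (Qx 0%N) => ->; rewrite horner0.
have [C1 C10 H1] := orbit_growth Qx; have [C2 H2] := @lden_quot_le R P Q Q0.
exists ((size Q).-1%:R * L + C1 + `|C2|).
  by rewrite !addr_ge0// mulr_ge0// ltW.
move=> j; apply: le_trans (H2 _ (Qx j)) _; rewrite !mulrDl.
have := H1 j; rewrite ler_norml => /andP[_ h].
have := ler_norm C2; have e1 := expr_ge1 j.
have : C1 <= C1 * d%:R ^+ j by rewrite ler_peMr.
have : `|C2| <= `|C2| * d%:R ^+ j by rewrite ler_peMr.
lra.
Qed.

Lemma sum_expr_le i : \sum_(j < i) d%:R ^+ j <= d%:R ^+ i :> R.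
Proof.
elim: i => [|i IH]; first by rewrite big_ord0.
rewrite big_ord_recr/= exprS.
have d2 : 2 <= d%:R :> R by rewrite ler_nat.
have E0 : 0 <= d%:R ^+ i :> R by rewrite exprn_ge0.
by have := ler_wpM2r E0 d2; lra.
Qed.

Variables (p q : {poly rat}).
Hypotheses (p0 : p != 0) (q0 : q != 0).

Let X m := mahler_poly d A p m.
Let Y m := mahler_poly d B q m.
Let r m : rat := (X m).[b%:~R] / (Y m).[b%:~R].
Let D m := (size (Y m %/ gcdp (X m) (Y m))).-1.

Lemma orbit_approx_shift i m :
  r (i + m) = (\prod_(j < i) s j) * ((X m).[(x i)%:~R] / (Y m).[(x i)%:~R]).
Proof.
rewrite /r /X /Y !mahler_poly_shift -/(X m) -/(Y m) prodf_div invfM mulrACA.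
by congr (_ / _ * (_ / _)); rewrite /x ?rmorphXn//; apply: eq_bigr => j _; rewrite rmorphXn.
Qed.

Lemma lden_reduced m : exists (C : R) M, forall i, (M <= i)%N ->
  `|lden R ((X m).[(x i)%:~R] / (Y m).[(x i)%:~R]) - (D m)%:R * (L * d%:R ^+ i)| <= C.
Proof.
have Y0 : Y m != 0 by exact: mahler_poly_neq0.
pose G := gcdp (X m) (Y m).
have G0 : G != 0 by rewrite gcdp_eq0 negb_and Y0 orbT.
have cop : coprimep (X m %/ G) (Y m %/ G) by apply: coprimep_div_gcd; rewrite Y0 orbT.
have Q0 : Y m %/ G != 0 by rewrite dvdp_div_eq0// dvdp_gcdr.
have [C [X0 H]] := @lden_coprime R _ _ cop Q0.
have [M1 H1] := orbit_unbounded X0.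
have [CG [M2 H2]] := orbit_growth_eventually G0.
exists C, (maxn M1 M2) => i; rewrite geq_max => /andP[/H1 h1 /H2[h2 _]].
have := H _ h1; rewrite ln_orbit.
have -> : (X m).[(x i)%:~R] = (X m %/ G).[(x i)%:~R] * G.[(x i)%:~R].
  by rewrite -hornerM divpK// dvdp_gcdl.
have -> : (Y m).[(x i)%:~R] = (Y m %/ G).[(x i)%:~R] * G.[(x i)%:~R].
  by rewrite -hornerM divpK// dvdp_gcdr.
by rewrite -mulf_div divff// mulr1.
Qed.

Lemma reduced_degree_le m : (D m + (size B).-1 <= d ^ m * ((size q).-1 + (size B).-1))%N.
Proof.
have Y0 : Y m != 0 by exact: mahler_poly_neq0.
have -> : D m = ((size (Y m)).-1 - (size (gcdp (X m) (Y m))).-1)%N.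
  have g0 : gcdp (X m) (Y m) != 0 by rewrite gcdp_eq0 negb_and Y0 orbT.
  rewrite /D size_divp//; have := dvdp_leq Y0 (dvdp_gcdr (X m) (Y m)).
  by move: g0; rewrite -size_poly_gt0; move: (size (gcdp _ _)) (size (Y m)) => u v; lia.
apply: (@leq_trans ((size (Y m)).-1 + (size B).-1)); first by rewrite leq_add2r leq_subr.
elim: m {Y0} => [|m IH]; first by rewrite expn0 mul1n.
rewrite size_mahler_poly// expnS -mulnA -/(Y m).
apply: leq_trans (leq_mul (leqnn d) IH); rewrite mulnDr.
by rewrite addnAC addnC leq_add2l addnn -mul2n leq_mul2r hd orbT.
Qed.

Lemma denq_rate : exists2 gam : rat, rate d (fun m => (denq (r m))%:~R) (ratr gam * L) &
  gam <= ((size q).-1 + (size B).-1)%:R.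
Proof.
have [gam Hg] := reduced_degree_rat hd A0 B0 p0 q0.
exists gam; last first.
  apply/ler_addgt0Pr => eps eps0; have [m _ hm] := Hg eps 0%N eps0.
  have : (D m)%:R / d%:R ^+ m <= ((size q).-1 + (size B).-1)%:R :> rat.
    rewrite ler_pdivrMr ?exprn_gt0 ?ltr0n// -natrX -natrM ler_nat mulnC.
    by apply: leq_trans (reduced_degree_le m); rewrite leq_addr.
  by move: hm; rewrite -/(X m) -/(Y m) -/(D m) ler_norml => /andP[? ?]; lra.
have [C1 C10 H1] := lden_orbit_quot A hB; have [C2 C20 H2] := lden_orbit_quot B hA.
pose C := C1 + C2.
have shift i m : `|lden R (r (i + m)) - lden R ((X m).[(x i)%:~R] / (Y m).[(x i)%:~R])|
    <= C * d%:R ^+ i.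
  rewrite orbit_approx_shift.
  apply: le_trans (@lden_prod_mul R i s _ (fun j => C * d%:R ^+ j) s0 _ _) _.
  - move=> j; apply: (le_trans (H1 j)); rewrite ler_wpM2r ?exprn_ge0//; rewrite /C; lra.
  - move=> j; rewrite /s invf_div; apply: (le_trans (H2 j)).
    by rewrite ler_wpM2r ?exprn_ge0//; rewrite /C; lra.
  - by rewrite -mulr_sumr ler_wpM2l ?sum_expr_le//; rewrite /C; lra.
move=> eps eps0.
have [M HM] := @expdn_unbounded R d (3 * C / eps) hd.
pose eta : rat := (Num.bound (3 * L / eps)).+1%:R^-1.
have eta0 : 0 < eta by rewrite invr_gt0 ltr0n.
have etaL : 3 * (ratr eta * L) <= eps.
  rewrite /eta fmorphV/= ratr_nat mulrCA mulrC ler_pdivrMr ?ltr0n// [leRHS]mulrC -ler_pdivrMr//.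
  apply: (le_trans (ltW (archi_boundP _))); first by rewrite divr_ge0 ?mulr_ge0 ?ltW.
  by rewrite ler_nat.
have [m /HM Cm hm] := Hg eta M eta0.
have [Cr [M1 Hr]] := lden_reduced m.
have [M2 HM2] := @expdn_unbounded R d (3 * Cr / eps) hd.
exists (m + (M1 + M2))%N => N mN.
pose i := (N - m)%N.
have NE : N = (i + m)%N by rewrite subnK// (leq_trans _ mN)// leq_addr.
have M1i : (M1 <= i)%N by rewrite leq_subRL ?(leq_trans _ mN) ?leq_addr// leq_add2l leq_addr.
have M2N : (M2 <= N)%N by rewrite (leq_trans _ mN)// addnA leq_addl.
have := HM2 N M2N; have := shift i m; have := Hr i M1i.
rewrite -NE -/(lden R (r N)).
have E0 : 0 < d%:R ^+ m :> R by rewrite exprn_gt0// ltr0n.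
have F0 : 0 < d%:R ^+ i :> R by rewrite exprn_gt0// ltr0n.
have EF : d%:R ^+ N = d%:R ^+ i * d%:R ^+ m :> R by rewrite NE exprD.
have degm : `|(D m)%:R - ratr gam * d%:R ^+ m : R| <= ratr eta * d%:R ^+ m.
  have -> : (D m)%:R - ratr gam * d%:R ^+ m = ratr ((D m)%:R / d%:R ^+ m - gam) * d%:R ^+ m :> R.
    rewrite rmorphB fmorph_div/= rmorphXn/= !ratr_nat; field.
    by rewrite -natrX pnatr_eq0 -lt0n expn_gt0 d0.
  rewrite normrM (gtr0_norm E0); apply: ler_wpM2r; first exact: ltW.
  by rewrite -ratr_norm ler_rat.
rewrite EF; move: E0 F0 degm Cm.
move: (d%:R ^+ m) (d%:R ^+ i) (lden R (r N)) (lden R _) => E F u v E0 F0.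
rewrite !ler_norml !ler_pdivrMr// => /andP[a1 a2] h1 /andP[w1 w2] /andP[c1 c2] h2.
have := ler_wpM2r (ltW F0) h1.
have LF : 0 <= L * F by rewrite mulr_ge0 ?ltW.
have := ler_wpM2r LF a1; have := ler_wpM2r LF a2.
have EF0 : 0 <= E * F by rewrite mulr_ge0 ?ltW.
have := ler_wpM2r EF0 etaL.
by move=> *; apply/andP; split; lra.
Qed.

Lemma natr_le_eps_expr (c eps : R) : 0 < eps ->
  exists M, forall m, (M <= m)%N -> c * m%:R <= eps * d%:R ^+ m.
Proof.
move=> eps0.
have sq m : (4 <= m)%N -> (m ^ 2 <= d ^ m)%N.
  move=> m4; apply: (@leq_trans (2 ^ m)); last by rewrite leq_exp2r// (leq_trans _ m4).
  elim: m m4 => // m IH; rewrite leq_eqVlt => /orP[/eqP<-//|m4].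
  rewrite [X in (_ <= X)%N]expnS; apply: leq_trans (leq_mul (leqnn 2) (IH m4)).
  by rewrite -!mulnn; move: m4; clear; nia.
exists (4 + Num.bound `|c / eps|)%N => m mm.
have m4 : (4 <= m)%N by apply: leq_trans mm; rewrite leq_addr.
have cm : c <= eps * m%:R.
  rewrite mulrC -ler_pdivrMr//; apply: (le_trans (ltW (lt_natr_bound _))).
  by rewrite ler_nat (leq_trans _ mm)// leq_addl.
apply: (@le_trans _ _ (eps * m%:R * m%:R)); first by rewrite ler_wpM2r.
rewrite -mulrA; apply: ler_wpM2l; first exact: ltW.
by rewrite -natrM -natrX ler_nat mulnn sq.
Qed.

Lemma orbit_prod_rate (u : nat -> R) (w C : R) (M0 : nat) :
  (forall m, (M0 <= m)%N -> 0 < u m /\ `|ln (u m) + w * (L * d%:R ^+ m)| <= C) ->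
  rate d (fun m => `|ratr (\prod_(j < m) s j)| * u m)
    (((((size A).-1)%:R - ((size B).-1)%:R) / (d%:R - 1) - w) * L).
Proof.
move=> Hu.
have [C1 C10 H1] := orbit_growth hA; have [C2 C20 H2] := orbit_growth hB.
pose k : R := ((size A).-1)%:R - ((size B).-1)%:R.
have d1 : 0 < d%:R - 1 :> R by rewrite subr_gt0 ltr1n.
have prodE m : `|ln `|ratr (\prod_(j < m) s j) : R| - k / (d%:R - 1) * L * (d%:R ^+ m - 1)|
    <= (C1 + C2) * m%:R.
  elim: m => [|m IH].
    by rewrite big_ord0 rmorph1 normr1 ln1 expr0 subrr mulr0 subrr normr0 mulr0.
  rewrite big_ord_recr/= rmorphM/= normrM lnM ?posrE; first last.
  - by rewrite normr_gt0 fmorph_eq0.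
  - by rewrite normr_gt0 fmorph_eq0; apply/prodf_neq0.
  have -> : ln `|ratr (s m) : R| = ln `|ratr A.[(x m)%:~R]| - ln `|ratr B.[(x m)%:~R] : R|.
    rewrite /s fmorph_div/= [in LHS]normrM normfV ln_div// posrE normr_gt0 fmorph_eq0//.
  have : k / (d%:R - 1) * L * (d%:R ^+ m.+1 - 1) =
      k / (d%:R - 1) * L * (d%:R ^+ m - 1) + k * (L * d%:R ^+ m).
    by rewrite exprS; field; rewrite gt_eqF.
  move=> ->; have -> : (C1 + C2) * m.+1%:R = (C1 + C2) * m%:R + (C1 + C2).
    by rewrite -natr1; ring.
  move: (H1 m) (H2 m) IH; rewrite /k !ler_norml => /andP[? ?] /andP[? ?] /andP[? ?].
  by apply/andP; split; lra.
move=> eps eps0.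
pose K := k / (d%:R - 1) * L.
have [M1 HM1] := @natr_le_eps_expr (2 * (C1 + C2)) eps eps0.
have [M2 HM2] := @expdn_unbounded R d (2 * (C + `|K|) / eps) hd.
exists (M0 + M1 + M2)%N => m mm.
have m0 : (M0 <= m)%N by apply: leq_trans mm; rewrite -addnA leq_addr.
have m1 : (M1 <= m)%N by apply: leq_trans mm; rewrite addnAC leq_addl.
have m2 : (M2 <= m)%N by apply: leq_trans mm; rewrite leq_addl.
have [um hu] := Hu m m0; have := HM1 m m1; have := HM2 m m2; rewrite ler_pdivrMr//.
have := prodE m; rewrite -/k -/K lnM ?posrE//; last first.
  by rewrite normr_gt0 fmorph_eq0; apply/prodf_neq0.
have -> : (k / (d%:R - 1) - w) * L = K - w * L by rewrite /K; ring.
move: hu (ler_norm K) (ler_norm (- K)); rewrite normrN !ler_norml.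
by move=> /andP[? ?] ? ? /andP[? ?] ? ?; apply/andP; split; lra.
Qed.

End OrbitRates.

(** * Evaluation of Laurent series *)

Section LaurentEval.
Variable R : realType.
Implicit Types (a : int -> R) (x s rho : R).

(** With symmetric partial sums, multiplying a Laurent series by z changes
    only two boundary terms of each sum. *)
Definition sym_sum (h : int -> R) (M : nat) : R :=
  \sum_(i < M) h i.+1%:Z + \sum_(i < M.+1) h (- i%:Z).

Lemma sym_sumS h M : sym_sum h M.+1 = sym_sum h M + h M.+1%:Z + h (- M.+1%:Z).
Proof. by rewrite /sym_sum big_ord_recr/= [X in _ + X]big_ord_recr/=; ring. Qed.

Lemma sym_sum0 h : sym_sum h 0 = h 0.
Proof. by rewrite /sym_sum big_ord0 big_ord1 add0r oppr0. Qed.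

Definition leval a x s := (sym_sum (fun k => a k * x ^ k) M) @[M --> \oo] --> s.

Definition coef_bound a rho := (exists N : nat, forall n : int, N%:Z < n -> a n = 0) /\
  (exists K : R, forall n : nat, `|a (- n%:Z)| <= K * rho ^+ n).

Lemma sym_sumD h1 h2 M : sym_sum (fun k => h1 k + h2 k) M = sym_sum h1 M + sym_sum h2 M.
Proof. by rewrite /sym_sum !big_split/=; ring. Qed.

Lemma sym_sumZ c h M : sym_sum (fun k => c * h k) M = c * sym_sum h M.
Proof. by rewrite /sym_sum -!mulr_sumr mulrDr. Qed.

Lemma levalD a1 a2 x s1 s2 : leval a1 x s1 -> leval a2 x s2 ->
  leval (fun k => a1 k + a2 k) x (s1 + s2).
Proof.
move=> h1 h2; rewrite /leval.
rewrite (_ : sym_sum _ = fun M => sym_sum (fun k => a1 k * x ^ k) M + sym_sum (fun k => a2 k * x ^ k) M).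
  exact: cvgD.
by apply/funext => M; rewrite -sym_sumD; congr sym_sum; apply/funext => k; rewrite mulrDl.
Qed.

Lemma levalZ c a x s : leval a x s -> leval (fun k => c * a k) x (c * s).
Proof.
move=> h; rewrite /leval.
rewrite (_ : sym_sum _ = fun M => c * sym_sum (fun k => a k * x ^ k) M).
  by apply: cvgM => //; exact: cvg_cst.
by apply/funext => M; rewrite -sym_sumZ; congr sym_sum; apply/funext => k; rewrite mulrA.
Qed.

Lemma leval_unique a x s1 s2 : leval a x s1 -> leval a x s2 -> s1 = s2.
Proof. by move=> h1 h2; apply: cvg_unique h1 h2; exact: Rhausdorff. Qed.

Lemma coef_boundD a1 a2 rho : 0 <= rho -> coef_bound a1 rho -> coef_bound a2 rho ->
  coef_bound (fun k => a1 k + a2 k) rho.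
Proof.
move=> rho0 [[N1 H1] [K1 B1]] [[N2 H2] [K2 B2]]; split.
  by exists (N1 + N2)%N => n hn; rewrite H1 ?H2 ?addr0//; lia.
exists (K1 + K2) => n; apply: le_trans (ler_normD _ _) _.
by rewrite mulrDl lerD.
Qed.

Lemma coef_boundZ c a rho : coef_bound a rho -> coef_bound (fun k => c * a k) rho.
Proof.
move=> [[N1 H1] [K1 B1]]; split.
  by exists N1 => n hn; rewrite H1 ?mulr0.
by exists (`|c| * K1) => n; rewrite normrM -mulrA ler_wpM2l.
Qed.

Lemma coef_bound_shift1 a rho : 0 < rho -> coef_bound a rho -> coef_bound (fun k => a (k - 1)) rho.
Proof.
move=> rho0 [[N1 H1] [K1 B1]]; split.
  by exists N1.+1 => n hn; apply: H1; lia.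
exists (K1 * rho) => n; have := B1 n.+1; rewrite exprS mulrA.
by have -> : - n%:Z - 1 = - n.+1%:Z by lia.
Qed.

Lemma coef_bound_cvg0 a rho x : 0 < rho -> rho < `|x| -> coef_bound a rho ->
  (a (- M%:Z) * x ^ (- M%:Z)) @[M --> \oo] --> (0 : R).
Proof.
move=> rho0 rhox [_ [K B]]; have x0 : 0 < `|x| by apply: lt_trans rhox.
have gc : (K * (rho / `|x|) ^+ M) @[M --> \oo] --> (0 : R).
  rewrite -[X in _ --> X](mulr0 K); apply: cvgM; first exact: cvg_cst.
  by apply: cvg_expr; rewrite ger0_norm ?divr_ge0 ?ltW// ltr_pdivrMr// mul1r.
apply/cvgr0Pnorm_le => e e0; move/cvgr0Pnorm_le : gc => /(_ e e0).
apply: filterS => M; apply: le_trans; rewrite normrM.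
apply: (@le_trans _ _ (K * (rho / `|x|) ^+ M)); last exact: ler_norm.
rewrite -exprnN normfV normrX expr_div_n mulrA ler_wpM2r//.
Qed.

Lemma leval_shift1 a rho x s : 0 < rho -> rho < `|x| -> coef_bound a rho ->
  leval a x s -> leval (fun k => a (k - 1)) x (x * s).
Proof.
move=> rho0 rhox ab sx; have x0 : x != 0 by rewrite -normr_gt0 (lt_trans rho0).
pose h k := a k * x ^ k.
have E M : sym_sum (fun k => a (k - 1) * x ^ k) M =
    x * (sym_sum h M + h (- M.+1%:Z) - h M%:Z).
  elim: M => [|M IH].
    have -> : x * (sym_sum h 0 + h (- 1%:Z) - h 0%N) = x * h (- 1%:Z).
      by rewrite sym_sum0 addrAC subrr add0r.
    by rewrite sym_sum0 expr0z mulr1 sub0r /h -exprnN expr1 mulrCA divff// mulr1.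
  rewrite !sym_sumS IH.
  have e1 : a (M.+1%:Z - 1) * x ^ M.+1%:Z = x * h M%:Z.
    have -> : M.+1%:Z - 1 = M%:Z by lia.
    by rewrite /h -!exprnP exprS; ring.
  have e2 : a (- M.+1%:Z - 1) * x ^ (- M.+1%:Z) = x * h (- M.+2%:Z).
    have -> : - M.+1%:Z - 1 = - M.+2%:Z by lia.
    rewrite /h mulrCA; congr (_ * _).
    by rewrite -!exprnN [x ^+ M.+2]exprS invfM mulrA divff// mul1r.
  by rewrite e1 e2; ring.
rewrite /leval (_ : sym_sum _ = fun M => x * (sym_sum h M + h (- M.+1%:Z) - h M%:Z)); last first.
  exact/funext.
apply: cvgM; first exact: cvg_cst.
rewrite -[X in _ --> X](addr0 s) -[X in _ --> X](subr0 (s + 0)).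
apply: cvgB; first apply: cvgD => //.
  have := @coef_bound_cvg0 _ _ _ rho0 rhox ab.
  by rewrite -cvg_shiftS.
have [[N HN] _] := ab; apply: cvg_near_cst.
by exists N.+1 => // M /= NM; rewrite /h HN ?mul0r// ltz_nat.
Qed.

Lemma coef_bound_shift a rho n : 0 < rho -> coef_bound a rho -> coef_bound (fun k => a (k - n%:Z)) rho.
Proof.
move=> rho0 ab; elim: n => [|n IH]; first by under eq_fun do rewrite subr0.
have := coef_bound_shift1 rho0 IH; congr coef_bound; apply/funext => k.
by congr a; lia.
Qed.

Lemma leval_shift a rho x s n : 0 < rho -> rho < `|x| -> coef_bound a rho ->
  leval a x s -> leval (fun k => a (k - n%:Z)) x (x ^+ n * s).
Proof.
move=> rho0 rhox ab sx; elim: n => [|n IH].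
  by rewrite expr0 mul1r; under eq_fun do rewrite subr0.
have := leval_shift1 rho0 rhox (coef_bound_shift n rho0 ab) IH.
rewrite mulrA -exprS; congr leval; apply/funext => k.
by congr a; lia.
Qed.

Definition poly_mul (K : nzRingType) (P : {poly K}) (a : int -> K) (k : int) : K :=
  \sum_(i < size P) P`_i * a (k - i%:Z).

Lemma leval_poly_mul (P : {poly R}) a rho x s : 0 < rho -> rho < `|x| -> coef_bound a rho ->
  leval a x s -> leval (poly_mul P a) x (P.[x] * s).
Proof.
move=> rho0 rhox ab sx; rewrite horner_coef mulr_suml /poly_mul.
elim: (size P) => [|n IH].
  under eq_fun do rewrite big_ord0; rewrite big_ord0.
  have := levalZ (c := 0) sx; rewrite mul0r; congr leval.
  by apply/funext => k; rewrite mul0r.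
under eq_fun do rewrite big_ord_recr/=; rewrite big_ord_recr/=.
apply: levalD => //; rewrite -mulrA; apply: levalZ.
exact: leval_shift rho0 rhox ab sx.
Qed.

Lemma coef_bound_poly_mul (P : {poly R}) a rho : 0 < rho -> coef_bound a rho ->
  coef_bound (poly_mul P a) rho.
Proof.
move=> rho0 ab; rewrite /poly_mul; elim: (size P) => [|n IH].
  under eq_fun do rewrite big_ord0.
  have := coef_boundZ 0 ab; congr coef_bound.
  by apply/funext => k; rewrite mul0r.
under eq_fun do rewrite big_ord_recr/=.
by apply: coef_boundD => //; [exact: ltW|apply: coef_boundZ; exact: coef_bound_shift].
Qed.

(** [laurent_pow] for coefficients of any type, [z] being the zero *)
Definition pow_sub (d : nat) (T : Type) (z : T) (a : int -> T) (n : int) : T :=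
  if (d%:Z %| n)%Z then a (n %/ d%:Z)%Z else z.

Lemma leval_pow_sub (d : nat) a x s : (0 < d)%N -> leval a (x ^+ d) s ->
  leval (pow_sub d 0 a) x s.
Proof.
move=> d0; rewrite /leval => h.
rewrite (_ : sym_sum _ = fun M => sym_sum (fun k => a k * (x ^+ d) ^ k) (M %/ d)).
  exact: (cvg_comp _ _ (cvg_divnr d d0) h).
apply/funext; elim => [|M IH].
  by rewrite div0n !sym_sum0 /pow_sub dvdz0 div0z !expr0z.
rewrite sym_sumS IH divnS// /pow_sub.
have -> : (d%:Z %| M.+1%:Z)%Z = (d %| M.+1)%N by [].
have -> : (d%:Z %| (- M.+1%:Z)%R)%Z = (d %| M.+1)%N by rewrite !dvdzE abszN.
case: ifP => dM; last by rewrite !mul0r !addr0.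
have [q qE] := dvdnP dM; rewrite add1n sym_sumS -!addrA; congr (_ + _).
have -> : (M %/ d).+1 = q by rewrite -add1n -[1%N]/(true : nat) -dM -divnS// qE mulnK.
have d0' : d%:Z != 0 by rewrite eqz_nat -lt0n.
rewrite qE; have -> : (q * d)%N%:Z = q%:Z * d%:Z by rewrite PoszM.
by rewrite -mulNr !mulzK// ![_ * d%:Z]mulrC [x ^+ d]exprnP !exprz_exp.
Qed.

Lemma leval_bound a rho K x s : 0 < rho -> 2 * rho <= `|x| ->
  (forall n : int, 0 < n -> a n = 0) -> (forall n : nat, `|a (- n%:Z)| <= K * rho ^+ n) ->
  leval a x s -> `|s - a 0| <= 2 * K * rho / `|x|.
Proof.
move=> rho0 rhox az aK h.
have x0 : 0 < `|x| by apply: lt_le_trans rhox; rewrite mulr_gt0.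
have K0 : 0 <= K by have := aK 0%N; rewrite expr0 mulr1; apply: le_trans.
pose t := rho / `|x|.
have t0 : 0 <= t by rewrite divr_ge0// ltW.
have t2 : t <= 2^-1 by rewrite ler_pdivrMr// mulrC ler_pdivlMr// mulrC.
have E M : `|sym_sum (fun k => a k * x ^ k) M - a 0| <= K * t * (2 - 2 * t ^+ M).
  have tM i : 0 <= t ^+ i by rewrite exprn_ge0.
  elim: M => [|M IH].
    rewrite sym_sum0 expr0z mulr1 subrr normr0 expr0.
    by rewrite mulr1 subrr mulr0.
  rewrite sym_sumS az ?ltz_nat// mul0r addr0 addrAC.
  apply: le_trans (ler_normD _ _) _.
  have : `|a (- M.+1%:Z) * x ^ (- M.+1%:Z)| <= K * t ^+ M.+1.
    rewrite normrM -exprnN normfV normrX /t expr_div_n mulrA ler_wpM2r//.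
  move: IH (tM M) K0 t0 t2; rewrite exprS; move: (t ^+ M) => u.
  move=> h1 u0 K0' t0' t2' h2.
  have : 0 <= K * t * u * (1 - 2 * t) by rewrite !mulr_ge0//; lra.
  lra.
have hs : `|sym_sum (fun k => a k * x ^ k) M - a 0| @[M --> \oo] --> `|s - a 0|.
  by apply: cvg_norm; apply: cvgB => //; exact: cvg_cst.
have -> : 2 * K * rho / `|x| = K * t * 2 by rewrite /t; ring.
have : limn (fun M => `|sym_sum (fun k => a k * x ^ k) M - a 0|) <= K * t * 2.
  apply: limr_le; first by apply/cvg_ex; exists `|s - a 0|.
  apply: nearW => M; apply: le_trans (E M) _.
  have tM : 0 <= t ^+ M by rewrite exprn_ge0.
  apply: ler_wpM2l; [exact: mulr_ge0|lra].
by rewrite (cvg_lim _ hs).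
Qed.

End LaurentEval.

(** * The functional equation and Pade approximants *)

Section LaurentLink.
Variable R : realType.

Lemma laurent_radius_coef_bound (f : int -> rat) (x : R) : laurent f ->
  (laurent_radius R f < `|x|%:E)%E ->
  exists rho, [/\ 0 < rho, rho < `|x| & coef_bound (fun k => ratr (f k) : R) rho].
Proof.
move=> [N HN] /ereal_inf_lt[_ [y [y0 /= cy] <-]]; rewrite lte_fin => yx.
exists `|y|; split => //; first by rewrite normr_gt0.
split; first by exists `|N|%N => n hn; rewrite HN ?rmorph0//; lia.
have /cvg_series_cvg_0 c0 := cy.
have /cvg_seq_bounded[K [_ /(_ (`|K| + 1))]] : cvgn (laurent_term f y).
  by apply/cvg_ex; exists 0.
move=> /(_ _)/(_ _) H; exists (`|K| + 1) => n.
have := H; rewrite (le_lt_trans (ler_norm K)) ?ltrDl// => /(_ isT n Logic.I).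
rewrite /laurent_term /= normrM normfV normrX.
have yn : 0 < `|y| ^+ n by rewrite exprn_gt0// normr_gt0.
by rewrite ler_pdivrMr.
Qed.

Lemma leval_laurent_eval (f : int -> rat) (rho x : R) : 0 < rho -> rho < `|x| ->
  coef_bound (fun k => ratr (f k) : R) rho ->
  leval (fun k => ratr (f k)) x (laurent_eval f x).
Proof.
move=> rho0 rhox [[N HN] [K HK]].
have x0 : 0 < `|x| by apply: lt_trans rhox.
rewrite /leval /laurent_eval.
have -> : \sum_(n \in [set: nat]) ratr (f n.+1%:Z) * x ^+ n.+1 =
    \sum_(n < N) ratr (f n.+1%:Z) * x ^+ n.+1.
  rewrite (@fsbig_ord _ _ _ N (fun n => ratr (f n.+1%:Z) * x ^+ n.+1)).
  apply/esym/fsbig_widen => // n [_ /= nN].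
  by rewrite HN ?mul0r// ltz_nat ltnS leqNgt; apply/negP.
have tE n : laurent_term f x n = ratr (f (- n%:Z)) * x ^ (- n%:Z).
  by rewrite /laurent_term -exprnN.
have cs : cvgn (series (laurent_term f x)).
  apply: normed_cvg.
  apply: (@series_le_cvg _ _ (fun n => K * (rho / `|x|) ^+ n)).
  - by move=> n /=; exact: normr_ge0.
  - move=> n; have K0 : 0 <= K.
      by have := HK 0%N; rewrite expr0 mulr1; apply: le_trans.
    by rewrite mulr_ge0// exprn_ge0// divr_ge0// ltW.
  - move=> n /=; rewrite normrM normfV normrX expr_div_n mulrA.
    by rewrite ler_wpM2r// invr_ge0 exprn_ge0.
  - apply: is_cvg_geometric_series; rewrite ger0_norm ?divr_ge0 ?ltW//.
    by rewrite ltr_pdivrMr// mul1r.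
apply: cvgD.
  apply: cvg_near_cst; exists N => // M /= NM.
  rewrite -(subnKC NM) big_split_ord/= [X in _ + X]big1 ?addr0// => i _.
  by rewrite HN ?mul0r// ltz_nat ltnS leq_addr.
rewrite (_ : (fun M => _) = fun M => series (laurent_term f x) M.+1).
  by rewrite cvg_shiftS.
apply/funext => M; rewrite /series/= big_mkord; apply: eq_bigr => i _.
by rewrite tE.
Qed.

End LaurentLink.

Lemma fsum_int_window (h : int -> rat) (lo : int) (m : nat) :
  (forall i, h i != 0 -> lo <= i < lo + m%:Z) ->
  \sum_(i \in [set: int]) h i = \sum_(i < m) h (lo + i%:Z).
Proof.
move=> H; rewrite (@fsbig_ord _ _ _ m (fun i => h (lo + i%:Z))).
rewrite -(@fsbig_image _ _ _ _ _ `I_m (fun i : nat => lo + i%:Z) h) /=; last first.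
  by move=> i j _ _ /addrI[].
apply/esym/fsbig_widen => // i [_ /= iB].
apply/eqP/negP => /negP/H /andP[h1 h2]; apply: iB.
exists `|i - lo|%N; lia.
Qed.

Lemma laurent_mul_poly (P : {poly rat}) (g : int -> rat) n :
  laurent_mul (laurent_poly P) g n = poly_mul P g n.
Proof.
rewrite /laurent_mul (@fsum_int_window _ 0 (size P)).
  by apply: eq_bigr => i _; rewrite add0r.
move=> [i|i]; rewrite /= ?mul0r ?eqxx// => h; rewrite add0r ltz_nat.
by rewrite ltnNge; apply: contra h => h; rewrite nth_default// mul0r.
Qed.

Lemma laurent_mul_polyA (P : {poly rat}) (D g : int -> rat) : laurent D -> laurent g ->
  laurent_mul (laurent_poly P) (laurent_mul D g) =
  laurent_mul (laurent_mul (laurent_poly P) D) g.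
Proof.
move=> [N1 H1] [N2 H2]; apply/funext => n; rewrite laurent_mul_poly.
pose lo : int := n - N2.
have [k hk] : exists k, forall j, (j < size P)%N -> (j < k)%N by exists (size P).
pose m := (`|lo|%N + `|N1|%N + k + 1)%N.
pose N3 : int := N1 + k%:Z.
have PD (i : int) : N3 < i -> poly_mul P D i = 0.
  move=> hi; rewrite /poly_mul big1// => -[j /= /hk hj] _; rewrite H1 ?mulr0//.
  by rewrite /N3 in hi; lia.
rewrite [RHS]/laurent_mul (@fsum_int_window _ lo m); last first.
  move=> i; rewrite laurent_mul_poly mulf_eq0 negb_or => /andP[h1 h2].
  have {h1} : ~~ (N3 < i) by apply: contra h1 => /PD ->.
  have {h2} : ~~ (N2 < n - i) by apply: contra h2 => /H2 ->.
  by rewrite /N3 /m /lo; lia.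
under [RHS]eq_bigr => i _ do rewrite laurent_mul_poly /poly_mul mulr_suml.
rewrite exchange_big/=; apply: eq_bigr => -[j /= jP] _; have hj := hk j jP.
rewrite /laurent_mul (@fsum_int_window _ (lo - j%:Z) m); last first.
  move=> i; rewrite mulf_eq0 negb_or => /andP[h1 h2].
  have {h1} : ~~ (N1 < i) by apply: contra h1 => /H1 ->.
  have {h2} : ~~ (N2 < n - j%:Z - i) by apply: contra h2 => /H2 ->.
  by rewrite /m /lo; lia.
rewrite mulr_sumr; apply: eq_bigr => i _; rewrite mulrA.
by congr (_ * D _ * g _); lia.
Qed.

Lemma laurent_pow_laurent (d : nat) (f : int -> rat) : (0 < d)%N -> laurent f ->
  laurent (laurent_pow d f).
Proof.
move=> d0 [N H]; exists (d%:Z * `|N|%:Z) => n hn; rewrite /laurent_pow; case: ifP => // dn.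
apply: H; have [q qE] := dvdzP dn; rewrite qE mulzK; last by lia.
by move: hn; rewrite qE; nia.
Qed.

Lemma laurent_div_laurent (A B : {poly rat}) : laurent (laurent_div A B).
Proof.
exists (size (A %/ B))%:Z => -[n|n] //= h; rewrite nth_default//.
by move: h; rewrite ltz_nat => /ltnW.
Qed.

Lemma functional_equation_coef (d : nat) (A B : {poly rat}) (f : int -> rat) : (0 < d)%N ->
  B != 0 -> laurent f -> f = laurent_mul (laurent_div A B) (laurent_pow d f) ->
  forall n, poly_mul B f n = poly_mul A (laurent_pow d f) n.
Proof.
move=> d0 B0 hf hfe n; rewrite -!laurent_mul_poly {1}hfe.
rewrite laurent_mul_polyA ?laurent_divK//.
  exact: laurent_div_laurent.
exact: laurent_pow_laurent.
Qed.

Lemma pade_exists (f : int -> rat) (n : nat) : laurent f ->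
  exists p q : {poly rat}, [/\ q != 0, (size q <= n.+1)%N &
    forall k : int, - n%:Z <= k -> poly_mul q f k = laurent_poly p k].
Proof.
move=> [N HN].
pose M : 'M[rat]_(n.+1, n) := \matrix_(i, j) f (- j.+1%:Z - i%:Z).
have : kermx M != 0.
  rewrite -mxrank_eq0 mxrank_ker -lt0n subn_gt0 ltnS rank_leq_col//.
move=> /rowV0Pn[v /sub_kermxP vM v0].
pose q : {poly rat} := \poly_(i < n.+1) v 0 (inord i).
have q0 : q != 0.
  apply: contra v0 => /eqP q0; apply/eqP/rowP => i; rewrite mxE.
  by have := congr1 (fun r : {poly rat} => r`_i) q0; rewrite coef_poly ltn_ord inord_val coef0.
have sq : (size q <= n.+1)%N by exact: size_poly.
have qE k : poly_mul q f k = \sum_(i < n.+1) q`_i * f (k - i%:Z).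
  rewrite /poly_mul (big_ord_widen _ (fun i : nat => q`_i * f (k - i%:Z)) sq) big_mkcond.
  by apply: eq_bigr => i _; case: ltnP => // h; rewrite nth_default// mul0r.
pose m := (`|N| + n).+2%N.
pose p : {poly rat} := \poly_(i < m) poly_mul q f i%:Z.
exists p, q; split => // -[k|k] hk.
  rewrite /laurent_poly coef_poly; case: ltnP => // mk.
  rewrite qE big1// => i _; rewrite HN ?mulr0//.
  by have := ltn_ord i; move: mk; rewrite /m; lia.
rewrite /= qE; have kn : (k < n)%N by move: hk; lia.
have := congr1 (fun w : 'rV_n => w 0 (Ordinal kn)) vM; rewrite !mxE => vk.
rewrite -[RHS]vk; apply: eq_bigr => i _; rewrite mxE coef_poly ltn_ord inord_val.
by congr (_ * f _); rewrite /=; lia.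
Qed.

(** * The case |b| >= 2 *)

Section CoefBounds.
Variable R : realType.

Lemma coef_bound_le (a : int -> R) (rho rho' : R) : 0 < rho -> rho <= rho' ->
  coef_bound a rho -> coef_bound a rho'.
Proof.
move=> rho0 rr [HN [K HK]]; split => //; exists K => n.
have K0 : 0 <= K by have := HK 0%N; rewrite expr0 mulr1; apply: le_trans.
apply: (le_trans (HK n)); rewrite ler_wpM2l// lerXn2r// nnegrE ltW//.
exact: lt_le_trans rr.
Qed.

Lemma coef_bound_pow_sub (d : nat) (a : int -> R) (rho : R) : (0 < d)%N -> 1 <= rho ->
  coef_bound a rho -> coef_bound (pow_sub d 0 a) rho.
Proof.
move=> d0 rho1 [[N HN] [K HK]]; split.
  exists (d * N)%N => n hn; rewrite /pow_sub; case: ifP => // dn.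
  apply: HN; have [q qE] := dvdzP dn; rewrite qE mulzK; last by lia.
  by move: hn; rewrite qE; nia.
have K0 : 0 <= K by have := HK 0%N; rewrite expr0 mulr1; apply: le_trans.
exists K => n; rewrite /pow_sub; case: ifP => dn; last first.
  by rewrite normr0 mulr_ge0// exprn_ge0// (le_trans _ rho1).
have {}dn : (d %| n)%N by move: dn; rewrite dvdzE abszN.
have [q ->] := dvdnP dn; rewrite PoszM -mulNr mulzK; last by lia.
apply: (le_trans (HK q)); rewrite ler_wpM2l// ler_weXn2l//.
by rewrite leq_pmulr.
Qed.

Definition delta0 (K : nzRingType) (k : int) : K := (k == 0)%:R.

Lemma leval_delta0 (x : R) : leval (@delta0 R) x 1.
Proof.
rewrite /leval (_ : sym_sum _ = cst 1); first exact: cvg_cst.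
apply/funext; elim => [|M IH]; first by rewrite sym_sum0 /delta0 eqxx expr0z mulr1.
by rewrite sym_sumS IH /delta0 oppr_eq0 /= !mul0r !addr0.
Qed.

Lemma coef_bound_delta0 (rho : R) : 0 < rho -> coef_bound (@delta0 R) rho.
Proof.
move=> rho0; split; first by exists 0%N => n n0; rewrite /delta0 gt_eqF.
exists 1 => -[|n]; first by rewrite /delta0 oppr0 eqxx normr1 expr0 mulr1.
by rewrite /delta0 oppr_eq0 normr0 mul1r exprn_ge0// ltW.
Qed.

Lemma poly_mul_delta0 (P : {poly rat}) k : poly_mul P (@delta0 rat) k = laurent_poly P k.
Proof.
rewrite /poly_mul /delta0; case: k => [m|m] /=; last first.
  rewrite big1// => i _; rewrite (_ : _ == 0 = false) ?mulr0//.
  by apply/negbTE; lia.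
have [mP|Pm] := ltnP m (size P).
  rewrite (bigD1 (Ordinal mP))//= subrr eqxx mulr1 big1 ?addr0// => i im.
  rewrite (_ : _ == 0 = false) ?mulr0//; apply: contraNF im.
  by rewrite subr_eq0 => /eqP[im]; apply/eqP/val_inj.
rewrite nth_default// big1// => -[i /= iP] _.
have im := leq_trans iP Pm.
by rewrite (_ : _ == 0 = false) ?mulr0//; apply/negbTE; lia.
Qed.

Lemma poly_mul_map (P : {poly rat}) (f : int -> rat) :
  poly_mul (map_poly (ratr : rat -> R) P) (fun k => ratr (f k)) =
  (fun k => ratr (poly_mul P f k)).
Proof.
apply/funext => k; rewrite /poly_mul size_map_poly rmorph_sum/=.
by apply: eq_bigr => i _; rewrite coef_map rmorphM.
Qed.

Lemma rate_ext (d : nat) (u v : nat -> R) (e : R) (M0 : nat) :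
  (forall m, (M0 <= m)%N -> u m = v m) -> rate d u e -> rate d v e.
Proof.
move=> uv ue eps eps0; have [M H] := ue eps eps0; exists (maxn M0 M) => m.
by rewrite geq_max => /andP[/uv <- /H].
Qed.

Lemma horner_map_rat (P : {poly rat}) (z : int) :
  (map_poly (ratr : rat -> R) P).[z%:~R] = ratr P.[z%:~R].
Proof. by rewrite -(ratr_int R) horner_map. Qed.

End CoefBounds.

Section LargeBase.
Variables (R : realType) (d : nat) (hd : (2 <= d)%N) (A B : {poly rat}) (f : int -> rat).
Variables (hB : B != 0) (hf : laurent f).
Variable hfe : f = laurent_mul (laurent_div A B) (laurent_pow d f).
Variables (b : int) (hb : (laurent_radius R f < (`|b%:~R : R|)%:E)%E) (b2 : (2 <= `|b|)%N).

Let x j : int := b ^+ (d ^ j).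

Variables (hA' : forall j, A.[(x j)%:~R] != 0) (hB' : forall j, B.[(x j)%:~R] != 0).
Variable xi_irr : forall r : rat, laurent_eval f (b%:~R : R) != ratr r.

Let d0 : (0 < d)%N. Proof. exact: ltnW. Qed.
Let xR j : R := (x j)%:~R.
Let ev j : R := laurent_eval f (xR j).
Let s j : rat := A.[(x j)%:~R] / B.[(x j)%:~R].

Let x0 : x 0 = b. Proof. by rewrite /x expn0 expr1. Qed.

Let xS j : xR j.+1 = xR j ^+ d.
Proof. by rewrite /xR /x expnSr exprM rmorphXn. Qed.

Lemma orbit_radius : exists rho : R, [/\ 1 <= rho, forall j, rho < `|xR j| &
  coef_bound (fun k => ratr (f k) : R) rho].
Proof.
have [rho [rho0 rhob hr]] := laurent_radius_coef_bound hf hb.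
have bR : 2 <= `|b%:~R : R| by rewrite -intr_norm (ler_int _ 2) /=; lia.
exists (Num.max 1 rho); split; first by rewrite le_max lexx.
  move=> j; apply: (@lt_le_trans _ _ `|b%:~R|); first by rewrite gt_max rhob andbT; lra.
  rewrite /xR /x rmorphXn/= normrX ler_eXnr ?expn_gt0 ?d0//; lra.
by apply: coef_bound_le hr => //; rewrite le_max lexx orbT.
Qed.

Lemma leval_orbit j : leval (fun k => ratr (f k)) (xR j) (ev j).
Proof.
have [rho [rho1 hr hrb]] := orbit_radius.
by apply: (leval_laurent_eval _ (hr j) hrb); apply: lt_le_trans rho1.
Qed.

Lemma ev_step j : ev j = ratr (s j) * ev j.+1.
Proof.
have [rho [rho1 hr hrb]] := orbit_radius; have rho0 : 0 < rho by apply: lt_le_trans rho1.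
have hB1 := leval_poly_mul (P := map_poly (ratr : rat -> R) B) rho0 (hr j) hrb (@leval_orbit j).
have h2 : leval (pow_sub d (0 : R) (fun k => ratr (f k))) (xR j) (ev j.+1).
  by apply: leval_pow_sub => //; rewrite -xS; exact: leval_orbit.
have hA1 := leval_poly_mul (P := map_poly (ratr : rat -> R) A) rho0 (hr j)
  (coef_bound_pow_sub d0 rho1 hrb) h2.
have E : poly_mul (map_poly (ratr : rat -> R) A) (pow_sub d 0 (fun k => ratr (f k) : R)) =
         poly_mul (map_poly (ratr : rat -> R) B) (fun k => ratr (f k)).
  have -> : pow_sub d 0 (fun k => ratr (f k) : R) = fun k => ratr (laurent_pow d f k).
    by apply/funext => k; rewrite /pow_sub /laurent_pow; case: ifP => // _; rewrite rmorph0.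
  rewrite !poly_mul_map; apply/funext => k.
  by rewrite (functional_equation_coef d0 hB hf hfe).
rewrite E in hA1; have := leval_unique hB1 hA1; rewrite /xR !horner_map_rat => h.
have B0 : ratr B.[(x j)%:~R] != 0 :> R by rewrite fmorph_eq0.
apply: (mulfI B0); rewrite h mulrA; congr (_ * _).
by rewrite -rmorphM/= /s mulrC divfK.
Qed.

Lemma ev_iter m : laurent_eval f (b%:~R : R) = ratr (\prod_(j < m) s j) * ev m.
Proof.
elim: m => [|m IH]; first by rewrite big_ord0 rmorph1 mul1r /ev /xR x0.
by rewrite IH (ev_step m) big_ord_recr/= [in RHS]rmorphM/= mulrA.
Qed.

Lemma ev_irr m (r : rat) : ev m != ratr r.
Proof.
apply/eqP => h; have := xi_irr ((\prod_(j < m) s j) * r).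
by rewrite (ev_iter m) h -rmorphM/= eqxx.
Qed.

Lemma pade_remainder (n : nat) (p q : {poly rat}) : q != 0 ->
  (forall k : int, - n%:Z <= k -> poly_mul q f k = laurent_poly p k) ->
  exists (o : nat) (C : R) (M0 : nat), (n < o)%N /\ forall m, (M0 <= m)%N ->
    let g := ratr q.[(x m)%:~R] * ev m - ratr p.[(x m)%:~R] in
    g != 0 /\ `|ln `|g| + o%:R * (ln `|b%:~R : R| * d%:R ^+ m)| <= C.
Proof.
move=> q0 hpq.
have [rho [rho1 hr hrb]] := orbit_radius; have rho0 : 0 < rho by apply: lt_le_trans rho1.
pose g k : rat := poly_mul q f k - laurent_poly p k.
pose gam m : R := ratr q.[(x m)%:~R] * ev m - ratr p.[(x m)%:~R].
have gE : (fun k => ratr (g k) : R) = fun k => poly_mul (map_poly (ratr : rat -> R) q) (fun k => ratr (f k)) k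
    + (- 1) * poly_mul (map_poly (ratr : rat -> R) p) (@delta0 R) k.
  have -> : @delta0 R = fun k => ratr (delta0 rat k).
    by apply/funext => k; rewrite /delta0 ratr_nat.
  by apply/funext => k; rewrite !poly_mul_map poly_mul_delta0 /g rmorphB mulN1r.
have glev m : leval (fun k => ratr (g k)) (xR m) (gam m).
  rewrite gE /gam -!horner_map_rat -[X in _ - X]mulr1 -[X in leval _ _ (_ + X)]mulN1r.
  apply: levalD; first exact: (leval_poly_mul rho0 (hr m) hrb (@leval_orbit m)).
  by apply/levalZ/(leval_poly_mul rho0 (hr m) (coef_bound_delta0 rho0))/leval_delta0.
have gbound : coef_bound (fun k => ratr (g k) : R) rho.
  rewrite gE; apply: coef_boundD; [exact: ltW|exact: coef_bound_poly_mul|].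
  by apply: coef_boundZ; apply: coef_bound_poly_mul => //; exact: coef_bound_delta0.
have gz (k : int) : - n%:Z <= k -> g k = 0 by move=> /hpq h; rewrite /g h subrr.
have [Mq Hq] : exists Mq, forall j, (Mq <= j)%N -> q.[(x j)%:~R] != 0.
  by have [C [M H]] := orbit_growth_eventually R hd b2 q0; exists M => j /H[].
have exo : exists o : nat, g (- o%:Z) != 0.
  apply: contrapT => /forallNP g0.
  have g00 k : g k = 0.
    case: (lerP (- n%:Z) k) => [/gz//|kn].
    have := g0 `|k|%N; have -> : - `|k|%N%:Z = k by lia.
    by move/negP; rewrite negbK => /eqP.
  have gam0 : gam Mq = 0.
    have := levalZ (c := 0) (glev Mq); rewrite mul0r => h.
    apply: leval_unique (glev Mq) _; move: h; congr leval.
    by apply/funext => k; rewrite g00 rmorph0 mulr0.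
  have := ev_irr Mq (p.[(x Mq)%:~R] / q.[(x Mq)%:~R]).
  rewrite fmorph_div/=; move: gam0; rewrite /gam => /subr0_eq <-.
  by rewrite mulrC mulKf ?eqxx// fmorph_eq0 Hq.
case: (ex_minnP exo) => o go omin.
have no : (n < o)%N.
  by rewrite ltnNge; apply/negP => on; move: go; rewrite gz ?eqxx//; lia.
pose a' (k : int) : R := ratr (g (k - o%:Z)).
have a'0 : a' 0 != 0 by rewrite /a' sub0r fmorph_eq0.
have a'z (k : int) : 0 < k -> a' k = 0.
  move=> k0; rewrite /a'; case: (lerP (- n%:Z) (k - o%:Z)) => [/gz->|kn]; first exact: rmorph0.
  apply/eqP; rewrite fmorph_eq0; apply/negP => /negP gk.
  have := omin `|k - o%:Z|%N; have -> : - `|(k - o%:Z)%R|%N%:Z = k - o%:Z by lia.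
  by move=> /(_ gk); lia.
have [_ [K HK]] : coef_bound a' rho by exact: (coef_bound_shift o rho0 gbound).
have a'lev m : leval a' (xR m) (xR m ^+ o * gam m).
  exact: (leval_shift (n := o) rho0 (hr m) gbound (glev m)).
have c0 : 0 < `|a' 0| by rewrite normr_gt0.
have [M HM] := orbit_unbounded hd b2 (2 * rho + 4 * K * rho / `|a' 0|).
have K0 : 0 <= K by have := HK 0%N; rewrite expr0 mulr1; apply: le_trans.
exists o, (ln 2 + `|ln `|a' 0| |), M; split => // m /HM hm /=; rewrite -/(gam m).
have x2 : 2 * rho <= `|xR m|.
  by apply: le_trans hm; rewrite lerDl divr_ge0// !mulr_ge0// ltW.
have xK : 4 * K * rho / `|a' 0| <= `|xR m|.
  by apply: le_trans hm; rewrite lerDr mulr_ge0// ltW.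
have xm0 : 0 < `|xR m| by rewrite (lt_le_trans _ x2)// mulr_gt0.
have := leval_bound rho0 x2 a'z HK (a'lev m) => hclose.
have [|] := @ln_close R (xR m ^+ o * gam m) (a' 0) a'0.
  apply: (le_trans hclose); rewrite ler_pdivrMr//.
  by move: xK; rewrite ler_pdivrMr//; lra.
rewrite mulf_eq0 negb_or => /andP[_ gm0] hl; split => //.
have lnx : ln `|xR m| = ln `|b%:~R : R| * d%:R ^+ m by exact: ln_orbit.
have gm0' : 0 < `|gam m| by rewrite normr_gt0.
have xo : 0 < `|xR m| ^+ o by rewrite exprn_gt0.
have lnE : ln `|xR m ^+ o * gam m| = o%:R * (ln `|b%:~R : R| * d%:R ^+ m) + ln `|gam m|.
  by rewrite normrM normrX lnM ?posrE// lnXn// lnx mulr_natl.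
move: hl; rewrite lnE.
move: (ler_norm (ln `|a' 0|)) (ler_norm (- ln `|a' 0|)); rewrite normrN !ler_norml.
by move=> ? ? /andP[? ?]; apply/andP; split; lra.
Qed.

Let L : R := ln `|b%:~R|.
Let c : rat := ((size A).-1 + (size B).-1)%:R.

Lemma pade_family (n : nat) : ((size A).-1 <= n)%N ->
  exists (r : nat -> rat) (e delta : rat),
  [/\ rate d (fun m => `|laurent_eval f (b%:~R : R) - ratr (r m)|) (- (ratr e * L)),
      rate d (fun m => (denq (r m))%:~R) (ratr delta * L),
      n%:R - c <= e - delta & delta <= n%:R + c].
Proof.
move=> An.
have [p [q [q0 sq hpq]]] := pade_exists n hf.
have [ o [C [M0 [no Hg]]]] := pade_remainder q0 hpq.
have [Cq [Mq Hq]] := orbit_growth_eventually R hd b2 q0.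
pose X m := mahler_poly d A p m; pose Y m := mahler_poly d B q m.
pose r m : rat := (X m).[b%:~R] / (Y m).[b%:~R].
have rE m : r m = (\prod_(j < m) s j) * (p.[(x m)%:~R] / q.[(x m)%:~R]).
  by have := orbit_approx_shift d b A B p q m 0; rewrite addn0.
pose g m := ratr q.[(x m)%:~R] * ev m - ratr p.[(x m)%:~R].
pose k : rat := (((size A).-1)%:R - ((size B).-1)%:R) / (d%:R - 1).
pose w : rat := o%:R + ((size q).-1)%:R.
have L2 : ln 2 <= L := ln_orbit_base_ge R hd b2.
have L0 : 0 < L by apply: lt_le_trans L2; rewrite ln_gt0// ltr1n.
have errE m : (Mq <= m)%N -> `|ratr (\prod_(j < m) s j)| * `|g m / ratr q.[(x m)%:~R]| =
    `|laurent_eval f (b%:~R : R) - ratr (r m)|.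
  move=> /Hq[qm _]; rewrite rE (ev_iter m) [in RHS]rmorphM/= -mulrBr -normrM.
  congr (`| _ * _ |); rewrite fmorph_div/= /g mulrBl mulrAC mulfV ?mul1r//.
  by rewrite fmorph_eq0.
have err_rate : rate d (fun m => `|laurent_eval f (b%:~R : R) - ratr (r m)|) (- (ratr (w - k) * L)).
  apply: rate_ext errE _.
  have -> : - (ratr (w - k) * L) =
      ((((size A).-1)%:R - ((size B).-1)%:R) / (d%:R - 1) - ratr w) * L.
    by rewrite /k rmorphB fmorph_div/= !rmorphB/= !ratr_nat rmorph1; ring.
  apply: (@orbit_prod_rate R d hd b b2 A B hA' hB' (fun m => `|g m / ratr q.[(x m)%:~R]|) (ratr w) (C + Cq) (M0 + Mq)) => m mm.
  have [g0 hg] := Hg m (leq_trans (leq_addr _ _) mm).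
  have [qm hq] := Hq m (leq_trans (leq_addl _ _) mm).
  have qR : 0 < `|ratr q.[(x m)%:~R] : R| by rewrite normr_gt0 fmorph_eq0.
  have gR : 0 < `|g m| by rewrite normr_gt0.
  split; first by rewrite normrM normfV divr_gt0.
  rewrite [`|g m / _|]normrM normfV ln_div ?posrE// /w rmorphD/= !ratr_nat.
  move: hg hq; rewrite -/(g m) -/L !ler_norml => /andP[? ?] /andP[? ?].
  by apply/andP; split; lra.
have d1 : 1 <= d%:R - 1 :> rat.
  have d2 : 2 <= d%:R :> rat by rewrite ler_nat.
  lra.
have kA : k <= ((size A).-1)%:R.
  have a0 : 0 <= ((size A).-1)%:R :> rat by rewrite ler0n.
  have b0 : 0 <= ((size B).-1)%:R :> rat by rewrite ler0n.
  rewrite /k ler_pdivrMr; last by lra.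
  by have := ler_wpM2l a0 d1; lra.
have on : n%:R + 1 <= o%:R :> rat by rewrite natr1 ler_nat.
have An' : ((size A).-1)%:R <= n%:R :> rat by rewrite ler_nat.
have q0' : 0 <= ((size q).-1)%:R :> rat by rewrite ler0n.
have e0 : 0 < ratr (w - k) * L.
  by rewrite mulr_gt0// ltr0q /w; lra.
have p0 : p != 0.
  apply/eqP => p0; have r0 m : r m = 0 by rewrite rE p0 horner0 mul0r mulr0.
  have [M1 H1] := err_rate (ratr (w - k) * L / 2) ltac:(lra).
  have [M2 H2] := @expdn_unbounded R d (2 * (1 + `|ln `|laurent_eval f (b%:~R : R)| |) / (ratr (w - k) * L)) hd.
  have := H1 _ (leq_addr M2 M1); have := H2 _ (leq_addl M1 M2).
  rewrite r0 rmorph0 subr0 ler_pdivrMr// ler_norml => h1 /andP[h2 h3].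
  have := ler_norm (- ln `|laurent_eval f (b%:~R : R)|); rewrite normrN; lra.
have [gam den_rate gam_le] := @denq_rate R d hd b b2 A B hA' hB' p q p0 q0.
exists r, (w - k), gam; split => //.
- by move: gam_le; rewrite /c /w !natrD; lra.
- apply: (le_trans gam_le); rewrite /c !natrD.
  have : ((size q).-1)%:R <= n%:R :> rat by rewrite ler_nat; case: (size q) sq.
  have a0 : 0 <= ((size A).-1)%:R :> rat by rewrite ler0n.
  lra.
Qed.

Lemma large_base_exponent : exists q : rat,
  irrationality_exponent (laurent_eval f (b%:~R : R)) = (ratr q : R)%:E.
Proof.
pose n0 := (size A).-1.
pose good n (t : (nat -> rat) * rat * rat) :=
  [/\ rate d (fun m => `|laurent_eval f (b%:~R : R) - ratr (t.1.1 m)|) (- (ratr t.1.2 * L)),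
      rate d (fun m => (denq (t.1.1 m))%:~R) (ratr t.2 * L),
      n%:R - c <= t.1.2 - t.2 & t.2 <= n%:R + c].
have [|F HF] := @choice _ _ (fun n t => (n0 <= n)%N -> good n t).
  move=> n; have [nn|nn] := leqP n0 n; last by exists ((fun=> 0), 0, 0).
  by have [r [e [delta h]]] := pade_family nn; exists (r, e, delta).
have L2 : ln 2 <= L := ln_orbit_base_ge R hd b2.
have L0 : 0 < L by apply: lt_le_trans L2; rewrite ln_gt0// ltr1n.
have rnat (n : nat) : ratr n%:R = n%:R :> R by rewrite ratr_nat.
apply: (@rational_exponent R d hd _ xi_irr (fun n => (F n).1.1) L (ratr c)
  (fun n => ratr (F n).1.2 * L) (fun n => ratr (F n).2 * L)
  (fun n => (F n).1.2 / (F n).2) n0) => //.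
- by rewrite ler0q ler0n.
- by move=> n /HF[].
- by move=> n /HF[].
- move=> n /HF[_ _ h _]; rewrite -mulrBl ler_wpM2r ?(ltW L0)//.
  by rewrite -rnat -!rmorphB ler_rat.
- move=> n /HF[_ _ _ h]; rewrite ler_wpM2r ?(ltW L0)//.
  by rewrite -rnat -rmorphD ler_rat.
- by move=> n _; rewrite -mulf_div divff ?mulr1 ?fmorph_div// gt_eqF.
Qed.

End LargeBase.

(** * Radius of convergence less than one *)

Lemma poly_mulD (P Q : {poly rat}) (a : int -> rat) k :
  poly_mul (P + Q) a k = poly_mul P a k + poly_mul Q a k.
Proof.
pose n := maxn (size P) (size Q).
have widen (S : {poly rat}) : (size S <= n)%N -> poly_mul S a k = \sum_(i < n) S`_i * a (k - i%:Z).
  move=> Sn; rewrite /poly_mul (big_ord_widen _ (fun i : nat => S`_i * a (k - i%:Z)) Sn) big_mkcond.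
  by apply: eq_bigr => i _; case: ltnP => // h; rewrite nth_default// mul0r.
rewrite !widen ?leq_maxl ?leq_maxr ?size_polyD// -big_split/=.
by apply: eq_bigr => i _; rewrite coefD mulrDl.
Qed.

Lemma poly_mulZX (c : rat) (n : nat) (a : int -> rat) k :
  poly_mul (c *: 'X^n) a k = c * a (k - n%:Z).
Proof.
rewrite /poly_mul; have [->|c0] := eqVneq c 0.
  by rewrite scale0r size_poly0 big_ord0 mul0r.
rewrite size_scale// size_polyXn (bigD1 ord_max)//= coefZ coefXn eqxx mulr1.
rewrite big1 ?addr0// => i; rewrite -val_eqE/= => /negbTE ni.
by rewrite coefZ coefXn ni mulr0 mul0r.
Qed.

Lemma poly_mul0 (a : int -> rat) k : poly_mul 0 a k = 0.
Proof. by rewrite /poly_mul size_poly0 big_ord0. Qed.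

Lemma poly_rat_ind (Pr : {poly rat} -> Prop) :
  Pr 0 -> (forall P Q, Pr P -> Pr Q -> Pr (P + Q)) -> (forall c n, Pr (c *: 'X^n)) ->
  forall P, Pr P.
Proof.
move=> P0 PD PX P; rewrite -[P]coefK poly_def.
by apply: big_ind => // i _; exact: PX.
Qed.

Lemma poly_mulM (P Q : {poly rat}) (a : int -> rat) k :
  poly_mul (P * Q) a k = poly_mul P (poly_mul Q a) k.
Proof.
elim/poly_rat_ind: P k => [|P1 P2 IH1 IH2|c n] k.
- by rewrite mul0r !poly_mul0.
- by rewrite mulrDl !poly_mulD IH1 IH2.
rewrite poly_mulZX; elim/poly_rat_ind: Q k => [|Q1 Q2 IH1 IH2|e m] k.
- by rewrite mulr0 !poly_mul0 mulr0.
- by rewrite mulrDr !poly_mulD IH1 IH2 mulrDr.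
rewrite -scalerAl -scalerAr -exprD scalerA !poly_mulZX -mulrA.
by congr (_ * (_ * a _)); lia.
Qed.

Lemma laurent_pow_poly_mul (d : nat) (P : {poly rat}) (a : int -> rat) k : (0 < d)%N ->
  laurent_pow d (poly_mul P a) k = poly_mul (P \Po 'X^d) (laurent_pow d a) k.
Proof.
move=> d0; have dz : d%:Z != 0 by lia.
elim/poly_rat_ind: P k => [|P1 P2 IH1 IH2|c n] k.
- by rewrite comp_poly0 poly_mul0 /laurent_pow; case: ifP => // _; rewrite poly_mul0.
- rewrite comp_polyD poly_mulD -IH1 -IH2 /laurent_pow; case: ifP => _; last by rewrite addr0.
  by rewrite poly_mulD.
rewrite comp_polyZ rmorphXn/= comp_polyX -exprM poly_mulZX /laurent_pow.
have -> : k - (d * n)%N%:Z = k + (- n%:Z) * d%:Z by rewrite PoszM; ring.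
case: (boolP (d%:Z %| k)%Z) => [/dvdzP[q ->]|dk]; last first.
  rewrite ifF ?mulr0//; apply: contraNF dk => /dvdzP[q kq].
  by apply/dvdzP; exists (q + n%:Z); rewrite mulrDl -kq mulNr addrNK.
by rewrite -mulrDl dvdz_mull// !mulzK// poly_mulZX.
Qed.

Lemma laurent_powM (d e : nat) (a : int -> rat) k : (0 < d)%N -> (0 < e)%N ->
  laurent_pow d (laurent_pow e a) k = laurent_pow (d * e) a k.
Proof.
move=> d0 e0; rewrite /laurent_pow PoszM.
case: (boolP (d%:Z %| k)%Z) => [/dvdzP[q ->]|dk]; last first.
  by rewrite ifF//; apply: contraNF dk; apply: dvdz_trans; rewrite dvdz_mulr.
rewrite mulzK; last by lia.
rewrite [q * _]mulrC dvdz_mul2l; last by lia.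
by case: ifP => // _; rewrite divzMpl//; lia.
Qed.

Section RationalCase.
Variables (d : nat) (hd : (2 <= d)%N) (A B : {poly rat}) (f : int -> rat).
Variables (B0 : B != 0) (hf : laurent f).
Variable fe : forall k, poly_mul B f k = poly_mul A (laurent_pow d f) k.

Let d0 : (0 < d)%N. Proof. exact: ltnW. Qed.

Lemma functional_equation_iter J k :
  poly_mul (mahler_poly d B 1 J) f k = poly_mul (mahler_poly d A 1 J) (laurent_pow (d ^ J) f) k.
Proof.
elim: J k => [|J IH] k.
  rewrite /= expn0 -[1]scale1r -(expr0 'X) !poly_mulZX /laurent_pow.
  by rewrite dvd1z divz1.
rewrite /= mulrC poly_mulM [in RHS]poly_mulM.
rewrite (_ : poly_mul B f = poly_mul A (laurent_pow d f)); last exact/funext.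
rewrite -poly_mulM mulrC poly_mulM; congr poly_mul; apply/funext => i.
rewrite -laurent_pow_poly_mul//.
rewrite (_ : poly_mul (mahler_poly d B 1 J) f =
  poly_mul (mahler_poly d A 1 J) (laurent_pow (d ^ J) f)); last exact/funext.
rewrite laurent_pow_poly_mul//; congr poly_mul; apply/funext => l.
by rewrite laurent_powM ?expn_gt0 ?d0// expnS.
Qed.

Lemma coef_clear (P : {poly rat}) : exists2 N : nat, (0 < N)%N &
  forall i, N%:R * P`_i \is a Num.int.
Proof.
have [q [a a0 ->]] := rat_poly_scale P; exists `|a|%N; first by rewrite absz_gt0.
move=> i; rewrite coefZ coef_map/= natr_absz.
have aq : a%:~R != 0 :> rat by rewrite intr_eq0.
case: (ger0P a) => _; first by rewrite mulVKf// intr_int.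
by rewrite rmorphN/= mulNr mulVKf// rpredN intr_int.
Qed.

Lemma laurent_denominators : exists h c : nat, (0 < h)%N /\
  forall n : nat, h%:R ^+ n * f (c%:Z - n%:Z) \is a Num.int.
Proof.
have [N HN] := hf; pose c := (`|N|%N).+1.
have cz (k : int) : c%:Z <= k -> f k = 0 by move=> ck; apply: HN; lia.
have [NA NA0 HA] := coef_clear A; have [NB NB0 HB] := coef_clear B.
pose be := (size B).-1; pose u n := f (c%:Z - n%:Z).
have sB : size B = be.+1 by rewrite prednK// lt0n size_poly_eq0.
pose E : rat := (NA * NB)%:R.
have EA i : E * A`_i \is a Num.int.
  by rewrite /E natrM mulrAC rpredM ?HA// natr_int.
have EB i : E * B`_i \is a Num.int.
  by rewrite /E natrM -mulrA rpredM ?HB// natr_int.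
have E0 : E != 0 by rewrite pnatr_eq0 muln_eq0 negb_or -!lt0n NA0.
have /Num.Theory.intrP[ell ellE] := EB be.
have ell0 : ell != 0.
  rewrite -(intr_eq0 rat) -ellE mulf_neq0// /be -lead_coefE lead_coef_eq0//.
pose n1 := (c + size A)%N.
pose W := (\prod_(n < n1.+1) `|denq (u n)|)%N.
pose h := (`|ell| * W)%N.
have W0 : (0 < W)%N by apply/prodn_gt0 => i; rewrite absz_gt0 denq_neq0.
have absint (z : int) (y : rat) : z%:~R * y \is a Num.int -> `|z|%N%:R * y \is a Num.int.
  rewrite natr_absz; case: (ger0P z) => // _.
  by rewrite rmorphN/= mulNr rpredN.
exists h, c; split; first by rewrite muln_gt0 absz_gt0 ell0.
elim/ltn_ind => -[|n] IH; first by rewrite subr0 cz// mulr0 rpred0.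
have [nn1|n1n] := leqP n.+1 n1.
  rewrite exprSr -mulrA rpredM ?rpredX ?natr_int//.
  rewrite /h natrM -mulrA rpredM ?natr_int//.
  have nn : (n.+1 < n1.+1)%N by [].
  rewrite /W (bigD1 (Ordinal nn))//= natrM mulrC mulrA rpredM ?natr_int// mulrC.
  by apply: absint; rewrite mulrC -numqE intr_int.
set k := c%:Z - n.+1%:Z.
have below (k' : int) : k < k' -> h%:R ^+ n * f k' \is a Num.int.
  move=> kk'; have [ck'|k'c] := lerP c%:Z k'; first by rewrite cz// mulr0 rpred0.
  pose n' := `|c%:Z - k'|%N.
  have nn' : (n' < n.+1)%N by rewrite /n' /k in kk' *; lia.
  have -> : k' = c%:Z - n'%:Z by rewrite /n'; lia.
  rewrite -(subnK (_ : n' <= n)%N)// exprD -mulrA rpredM ?rpredX ?natr_int//.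
  exact: IH.
have hk' : B`_be * f k = poly_mul A (laurent_pow d f) (k + be%:Z)
    - \sum_(i < be) B`_i * f (k + be%:Z - i%:Z).
  by rewrite -fe /poly_mul sB big_ord_recr/= addrK addrAC subrr add0r.
have belowF i : (i < size A)%N -> h%:R ^+ n * laurent_pow d f (k + be%:Z - i%:Z) \is a Num.int.
  move=> iA; rewrite /laurent_pow; case: ifP => [/dvdzP[q qE]|_]; last by rewrite mulr0 rpred0.
  rewrite qE mulzK; last by lia.
  apply: below; rewrite ltNge; apply/negP => qk.
  have kA : k + i%:Z < 0 by move: n1n iA; rewrite /k /n1; lia.
  have dk : d%:Z * k <= 2 * k.
    by rewrite [leLHS]mulrC [leRHS]mulrC ler_wnM2l ?lez_nat//; lia.
  have dq : q * d%:Z <= d%:Z * k by rewrite mulrC ler_wpM2l.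
  lia.
have swap (w y z v : rat) : w * (y * (z * v)) = y * z * (w * v) by ring.
have key : ell%:~R * (h%:R ^+ n * f k) \is a Num.int.
  rewrite -ellE mulrCA -mulrA hk' !mulrBr rpredB//.
    rewrite /poly_mul !mulr_sumr rpred_sum// => -[i /= iA] _.
    by rewrite swap rpredM ?EA ?belowF.
  rewrite !mulr_sumr rpred_sum// => -[i /= ib] _.
  by rewrite swap rpredM ?EB// below//; lia.
have -> : h%:R ^+ n.+1 * f k = W%:R * (`|ell|%N%:R * (h%:R ^+ n * f k)).
  by rewrite exprS {1}/h natrM; ring.
by rewrite rpredM ?natr_int// absint.
Qed.

End RationalCase.

Section SmallRadius.
Variables (R : realType) (d : nat) (hd : (2 <= d)%N) (A B : {poly rat}) (f : int -> rat).
Variables (B0 : B != 0) (hf : laurent f).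
Variable fe : forall k, poly_mul B f k = poly_mul A (laurent_pow d f) k.
Variables (rho : R) (rho0 : 0 < rho) (rho1 : rho < 1).
Variable hrho : coef_bound (fun k => ratr (f k) : R) rho.

Lemma expr_small (t eps : R) : 0 <= t -> t < 1 -> 0 < eps ->
  exists N, forall n, (N <= n)%N -> t ^+ n <= eps.
Proof.
move=> t0 t1 eps0.
have : (t ^+ n) @[n --> \oo] --> (0 : R) by apply: cvg_expr; rewrite ger0_norm.
move/cvgr0Pnorm_le => /(_ eps eps0) [N _ H]; exists N => n Nn.
by have := H n Nn; rewrite /= ger0_norm// exprn_ge0.
Qed.

Lemma poly_mul_eventually0 : exists J n1 : nat, forall n, (n1 <= n)%N ->
  poly_mul (mahler_poly d B 1 J) f (- n%:Z) = 0.
Proof.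
have [h [c [h0 hint]]] := laurent_denominators hd B0 hf fe.
have h0R : 0 < h%:R :> R by rewrite ltr0n.
have [J HJ] : exists J, h%:R * rho ^+ (d ^ J) <= 2^-1.
  have [|J HJ] := @expr_small rho (2^-1 / h%:R) (ltW rho0) rho1; first by rewrite divr_gt0.
  exists J; rewrite mulrC -ler_pdivlMr// HJ// ltnW// ltn_expl//.
pose D := (d ^ J)%N; have D0 : (0 < D)%N by rewrite expn_gt0 ltnW.
pose T := mahler_poly d B 1 J; pose U := mahler_poly d A 1 J.
have [M M0 HM] := coef_clear U; pose s := size U.
pose G n := poly_mul T f (- n%:Z).
have Gint n : M%:R * h%:R ^+ (c + (n + s) %/ D) * G n \is a Num.int.
  rewrite /G (functional_equation_iter hd fe) -/U -/D /poly_mul mulr_sumr rpred_sum// => -[i /= iU] _.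
  rewrite mulrACA rpredM ?HM// /laurent_pow; case: ifP => [dv|_]; last by rewrite mulr0 rpred0.
  have [q qE] : exists q : nat, (n + i)%N = (q * D)%N.
    apply/dvdnP; move: dv; rewrite dvdzE.
    by have -> : (`|(- n%:Z - i%:Z)%R| = n + i)%N by lia.
  have -> : - n%:Z - i%:Z = - q%:Z * D%:Z by rewrite mulNr -PoszM -qE; lia.
  rewrite mulzK; last by lia.
  have qt : (q <= (n + s) %/ D)%N.
    by rewrite leq_divRL// -qE leq_add2l ltnW.
  have -> : - q%:Z = c%:Z - (c + q)%N%:Z by lia.
  rewrite -(subnK (_ : c + q <= c + (n + s) %/ D)%N) ?leq_add2l//.
  by rewrite exprD -mulrA rpredM ?rpredX ?natr_int.
have [_ [K HK]] := coef_bound_poly_mul (map_poly (ratr : rat -> R) T) rho0 hrho.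
have {}HK n : `|ratr (G n)| <= K * rho ^+ n.
  by have := HK n; rewrite poly_mul_map.
have K0 : 0 <= K by have := HK 0%N; rewrite expr0 mulr1; apply: le_trans.
pose C : R := M%:R * h%:R ^+ c * K.
have C0 : 0 <= C by rewrite !mulr_ge0// exprn_ge0.
have [|t0 Ht0] := @expr_small (2^-1) (rho ^+ s / (2 * (C + 1))) ltac:(lra) ltac:(lra).
  by rewrite divr_gt0 ?exprn_gt0//; lra.
exists J, (D * t0)%N => n hn; apply/eqP/negP => /negP Gn0.
pose t := ((n + s) %/ D)%N.
have tt0 : (t0 <= t)%N.
  by rewrite leq_divRL// mulnC (leq_trans hn)// leq_addr.
have /Num.Theory.norm_intr_ge1 := Gint n.
rewrite !mulf_eq0 !negb_or Gn0 andbT pnatr_eq0 -lt0n M0 expf_neq0 ?pnatr_eq0 -?lt0n//.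
move=> /(_ isT); rewrite -(ler_rat R) rmorph1 ratr_norm !rmorphM/= rmorphXn/= !ratr_nat.
rewrite normrM (ger0_norm (_ : 0 <= M%:R * _)) ?mulr_ge0 ?exprn_ge0// exprD -/t => h1.
have h2 : 1 <= C * (h%:R ^+ t * rho ^+ n).
  apply: (le_trans h1); rewrite /C.
  have pos : 0 <= M%:R * (h%:R ^+ c * h%:R ^+ t) :> R by rewrite !mulr_ge0// exprn_ge0.
  apply: (le_trans (ler_wpM2l pos (HK n))); clear.
  move: (h%:R ^+ c) (h%:R ^+ t) (rho ^+ n) (M%:R) => w y z v.
  by rewrite le_eqVlt; apply/orP; left; apply/eqP; ring.
have rs0 : 0 < rho ^+ s by rewrite exprn_gt0.
have h3 : rho ^+ n * rho ^+ s <= rho ^+ (D * t).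
  by rewrite -exprD ler_wiXn2l ?ltW// mulnC leq_trunc_div.
have h4 : (h%:R * rho ^+ D) ^+ t <= 2^-1 ^+ t.
  by rewrite lerXn2r// nnegrE ?mulr_ge0// ?exprn_ge0 ?ltW//.
have h5 := Ht0 t tt0.
have : rho ^+ s <= C * 2^-1 ^+ t.
  have h6 : h%:R ^+ t * (rho ^+ n * rho ^+ s) <= 2^-1 ^+ t.
    by apply: le_trans h4; rewrite exprMn -exprM ler_wpM2l// exprn_ge0.
  have := ler_wpM2l C0 h6; have := ler_wpM2r (ltW rs0) h2.
  by rewrite mul1r !mulrA => /le_trans; apply.
have y0 : 0 < 2^-1 ^+ t :> R by rewrite exprn_gt0.
move: h5; rewrite ler_pdivlMr; last by rewrite mulr_gt0// ltr_wpDl.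
move: C0 rs0 y0; clear; move: (rho ^+ s) (2^-1 ^+ t) C => v y w w0 v0 y0 h1 h2.
have : 0 <= w * y by rewrite mulr_ge0// ltW.
lra.
Qed.

Lemma rational_value (b : int) : rho < `|b%:~R : R| ->
  (forall j, B.[b%:~R ^+ (d ^ j)] != 0) ->
  exists r : rat, laurent_eval f (b%:~R : R) = ratr r.
Proof.
move=> rb hB.
have [J [n1 Hn1]] := poly_mul_eventually0; set T := mahler_poly d B 1 J in Hn1.
have [N1 HN1] : exists N1 : nat, forall k : int, N1%:Z < k -> poly_mul T f k = 0.
  have [[N1 H] _] := coef_bound_poly_mul (map_poly (ratr : rat -> R) T) rho0 hrho.
  exists N1 => k /H; rewrite poly_mul_map => /eqP; rewrite fmorph_eq0 => /eqP//.
have := leval_poly_mul (P := map_poly (ratr : rat -> R) T) rho0 rb hrho (leval_laurent_eval rho0 rb hrho).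
rewrite poly_mul_map horner_map_rat => lev.
have T0 : T.[b%:~R] != 0.
  rewrite /T -[J]addn0 mahler_poly_shift /= hornerC mulr1.
  by apply/prodf_neq0 => j _; exact: hB.
have sumrat m : exists r : rat, sym_sum (fun k => ratr (poly_mul T f k) * b%:~R ^ k) m = ratr r :> R.
  have term k : ratr (poly_mul T f k) * b%:~R ^ k = ratr (poly_mul T f k * b%:~R ^ k) :> R.
    by rewrite rmorphM fmorphXz/= ratr_int.
  elim: m => [|m [r IH]].
    by rewrite sym_sum0 term; eexists.
  by rewrite sym_sumS IH !term -!rmorphD; eexists.
have [r Hr] := sumrat (n1 + N1)%N.
have {}Hr m : (n1 + N1 <= m)%N -> sym_sum (fun k => ratr (poly_mul T f k) * b%:~R ^ k) m = ratr r :> R.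
  elim: m => [|m IH]; first by rewrite leqn0 => /eqP <-.
  rewrite leq_eqVlt => /orP[/eqP <-//|]; rewrite ltnS => mm.
  rewrite sym_sumS IH// HN1 ?Hn1 ?rmorph0 ?mul0r ?addr0//.
    by rewrite (leq_trans _ (leqW mm))// leq_addr.
  by rewrite ltz_nat ltnS (leq_trans _ mm)// leq_addl.
have : leval (fun k => ratr (poly_mul T f k) : R) b%:~R (ratr r).
  by apply: cvg_near_cst; exists (n1 + N1)%N => // m /= /Hr.
move=> /(leval_unique lev) E; exists (r / T.[b%:~R]).
by rewrite fmorph_div/= -E mulrC mulKf// fmorph_eq0.
Qed.

End SmallRadius.

Theorem theorem1 (R : realType) (d : nat) (hd : (2 <= d)%N)
    (A B : {poly rat}) (hB : B != 0)
    (f : int -> rat) (hf : laurent f)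
    (hfe : f = laurent_mul (laurent_div A B) (laurent_pow d f))
    (b : int) (hb : (laurent_radius R f < (`|b%:~R : R|)%:E)%E)
    (hAB : forall m : nat,
      A.[b%:~R ^+ (d ^ m)%N] * B.[b%:~R ^+ (d ^ m)%N] != 0)
    (hirr : @irrational R (laurent_eval f (b%:~R : R))) :
  exists q : rat,
    irrationality_exponent (laurent_eval f (b%:~R : R)) = (ratr q : R)%:E.
Proof.
have irr (r : rat) : laurent_eval f (b%:~R : R) != ratr r.
  by apply/eqP => xr; apply: hirr; exists r.
have hA' j : A.[(b ^+ (d ^ j))%:~R] != 0.
  by have := hAB j; rewrite mulf_eq0 negb_or rmorphXn/= => /andP[].
have hB' j : B.[(b ^+ (d ^ j))%:~R] != 0.
  by have := hAB j; rewrite mulf_eq0 negb_or rmorphXn/= => /andP[].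
have [b2|b1] := leqP 2 `|b|%N; first exact: (large_base_exponent hd hB hf hfe hb b2 hA' hB' irr).
have [rho [rho0 rhob hrho]] := laurent_radius_coef_bound hf hb.
have rho1 : rho < 1.
  by apply: lt_le_trans rhob _; rewrite -intr_norm (ler_int _ _ 1); lia.
have hB1 j : B.[b%:~R ^+ (d ^ j)] != 0 by have := hB' j; rewrite rmorphXn.
have [r xr] := rational_value hd hB hf (functional_equation_coef (ltnW hd) hB hf hfe)
  rho0 rho1 hrho rhob hB1.
by have := irr r; rewrite xr eqxx.
Qed.
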